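(* Let $\{\mu_n\}_{n\in\mathbb{N}}$ be a uniformly computable sequence in $\mathcal{M}(\mathbb{R})$. The following are equivalent. (1) $\{\mu_n\}_{n\in\mathbb{N}}$ is effectively weakly convergent (i.e. there is $\mu\in\mathcal{M}(\mathbb{R})$ to which it effectively weakly converges). (2) $\{\mu_n\}_{n\in\mathbb{N}}$ is uniformly effectively weakly convergent (i.e. there is $\mu\in\mathcal{M}(\mathbb{R})$ to which it uniformly effectively weakly converges).
   Context: $\mathcal{M}(\mathbb{R})$ is the set of finite Borel measures on $\mathbb{R}$. $C_b(\mathbb{R})$ is the set of bounded continuous real functions on $\mathbb{R}$ and $C_b^c(\mathbb{R})$ the set of bounded computable functions $\mathbb{R}\to\mathbb{R}$. A Cauchy name of $x\in\mathbb{R}$ is a sequence of rationals $(q_n)$ with $q_n\to x$ and $|q_n-q_{n+1}|<2^{-n}$; $x$ is computable if it has a computable Cauchy name, and an index of $x$ is an index of such a name. A function $f:\mathbb{R}\to\mathbb{R}$ is computable if there is a Turing functional mapping every Cauchy name of $x$ to a Cauchy name of $f(x)$; an index of $f$ is an index of such a functional. Fix an effective enumeration $\{I_i\}$ of rational open intervals. An open $U\subseteq\mathbb{R}$ is $\Sigma^0_1$ if $\{i: I_i\subseteq U\}$ is c.e., and an index of $U$ is a c.e. index of this set. A measure $\mu\in\mathcal{M}(\mathbb{R})$ is computable if $\mu(\mathbb{R})$ is a computable real and from an index of a $\Sigma^0_1$ set $U$ one can compute an index of the left Dedekind cut of $\mu(U)$ (as a c.e. set); a sequence $\{\mu_n\}$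 is uniformly computable if $\mu_n$ is computable uniformly in $n$. For a compact rational interval $I$ and rational open interval $J$ let $N_{I,J}=\{f\in C(\mathbb{R}): f[I]\subseteq J\}$; a compact-open (c.o.) name of $f\in C(\mathbb{R})$ is an enumeration of $\{N_{I,J}: f\in N_{I,J}\}$. A modulus of convergence of a convergent real sequence $(a_n)$ with limit $a$ is a function $g:\mathbb{N}\to\mathbb{N}$ such that $|a_n-a|<2^{-k}$ whenever $n\ge g(k)$. The sequence $\{\mu_n\}$ effectively weakly converges to $\mu$ if for every $f\in C_b^c(\mathbb{R})$, $\lim_n\int f\,d\mu_n=\int f\,d\mu$, and an index of a modulus of convergence of $\{\int f\,d\mu_n\}_n$ can be computed from an index of $f$ and a bound $B\in\mathbb{N}$ on $|f|$. The sequence uniformly effectively weakly converges to $\mu$ if it weakly converges to $\mu$ and there is a uniform procedure which, for any $f\in C_b(\mathbb{R})$, computes a modulus of convergence of $\{\int f\,d\mu_n\}_n$ from a c.o. name of $f$ and a bound $B\in\mathbb{N}$ on $|f|$. *)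

(* Defs.v *)
From Stdlib Require Cantor.
From HB Require Import structures.
From mathcomp Require Import all_boot all_order all_algebra.
From mathcomp Require Import all_classical all_reals all_analysis.

Set Implicit Arguments.
Unset Strict Implicit.
Unset Printing Implicit Defensive.

Import Order.TTheory GRing.Theory Num.Theory.
Import numFieldNormedType.Exports.

Local Open Scope classical_set_scope.
Local Open Scope ring_scope.

(** * Turing functionals

    A Turing functional is presented as a partial recursive function relative
    to an oracle [p : nat -> nat].  All functions are unary; several arguments
    are packed with the Cantor pairing bijection. *)

Notation "<| a , b |>" := (Cantor.to_nat (a, b)) (at level 0, a, b at level 99).

Definition unpair1 (n : nat) : nat := (Cantor.of_nat n).1.
Definition unpair2 (n : nat) : nat := (Cantor.of_nat n).2.

Inductive code : Type :=
| CZero | CSucc | CFst | CSnd | COracle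
| CPair of code & code
| CComp of code & code
| CPrec of code & code
| CMu of code.

(** [eval p c n m]: the computation of [c] with oracle [p] on input [n] halts
    with output [m].  [CPrec f g] is primitive recursion with
    [h <|a, 0|> = f a] and [h <|a, k.+1|> = g <|a, <|k, h <|a, k|>|>|>];
    [CMu f] maps [n] to the least [m] with [f <|n, m|> = 0], all the previous
    values of [f] being defined. *)
Fixpoint prec_graph (F G : nat -> nat -> Prop) (a k : nat) : nat -> Prop :=
  match k with
  | 0 => F a
  | k'.+1 => fun s =>
      exists2 r, prec_graph F G a k' r & G <| a, <| k', r |> |> s
  end%N.

Fixpoint eval (p : nat -> nat) (c : code) (n m : nat) : Prop :=
  match c with
  | CZero => m = 0%N
  | CSucc => m = n.+1
  | CFst => m = unpair1 n
  | CSnd => m = unpair2 n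
  | COracle => m = p n
  | CPair f g => exists a b, [/\ eval p f n a, eval p g n b & m = <| a, b |>]
  | CComp f g => exists2 r, eval p g n r & eval p f r m
  | CPrec f g => prec_graph (eval p f) (eval p g) (unpair1 n) (unpair2 n) m
  | CMu f => eval p f <| n, m |> 0%N /\
             forall i, (i < m)%N -> exists v, eval p f <| n, i |> v.+1
  end.

Fixpoint encode (c : code) : nat :=
  match c with
  | CZero => 0
  | CSucc => 1
  | CFst => 2
  | CSnd => 3
  | COracle => 4
  | CPair f g => 5 + 4 * <| encode f, encode g |>
  | CComp f g => 6 + 4 * <| encode f, encode g |>
  | CPrec f g => 7 + 4 * <| encode f, encode g |>
  | CMu f => 8 + 4 * encode f
  end%N.

(** [Phi e p n m]: the [e]-th Turing functional with oracle [p] satisfies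
    Phi_e^p(n) = m. *)
Definition Phi (e : nat) (p : nat -> nat) (n m : nat) : Prop :=
  exists2 c, encode c = e & eval p c n m.

(** The [e]-th partial computable function. *)
Definition phi (e n m : nat) : Prop := Phi e (fun=> 0%N) n m.

Definition fun_index (g : nat -> nat) (e : nat) : Prop :=
  forall n, phi e n (g n).

Definition computable (g : nat -> nat) : Prop := exists e, fun_index g e.

(** [e] is a c.e. index of [A], i.e. A = W_e = dom phi_e. *)
Definition ce_index (A : set nat) (e : nat) : Prop :=
  A = [set n | exists m, phi e n m].

(** * Rationals and rational intervals *)

(** An effective surjection of [nat] onto [rat]:
    <|<|a, b|>, d|> codes (a - b) / (d + 1). *)
Definition ratn (n : nat) : rat :=
  ((unpair1 (unpair1 n))%:R - (unpair2 (unpair1 n))%:R) / (unpair2 n).+1%:R.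

(** An effective surjection of [nat] onto the positive rationals. *)
Definition posratn (n : nat) : rat := (unpair1 n).+1%:R / (unpair2 n).+1%:R.

(** The [i]-th rational interval has left endpoint [ratn (unpair1 i)] and
    length [posratn (unpair2 i)]; every pair of rationals a < b occurs. *)
Definition itv_lo (i : nat) : rat := ratn (unpair1 i).
Definition itv_hi (i : nat) : rat := itv_lo i + posratn (unpair2 i).

Section Reals.
Variable R : realType.
Implicit Types (x a l : R) (f : R -> R) (U : set R).

Definition open_itv (i : nat) : set R :=
  `]ratr (itv_lo i), ratr (itv_hi i)[%classic.
Definition compact_itv (i : nat) : set R :=
  `[ratr (itv_lo i), ratr (itv_hi i)]%classic.

(** * Computable reals and computable functions *)

(** Rationals being coded by [ratn], [p] codes a Cauchy name of [x]. *)
Definition cauchy_name x (p : nat -> nat) : Prop :=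
  ((ratr (ratn (p n)) : R) @[n --> \oo] --> x) /\
  forall n, `|ratn (p n) - ratn (p n.+1)| < 2 ^- n.

Definition real_index x (e : nat) : Prop :=
  exists2 p, cauchy_name x p & fun_index p e.

Definition realfun_index f (e : nat) : Prop :=
  forall x p, cauchy_name x p ->
    exists2 q, cauchy_name (f x) q & forall n, Phi e p n (q n).

Definition Cb : set (R -> R) := [set f | continuous f /\ bounded_fun f].

Definition Cbc : set (R -> R) :=
  [set f | (exists e, realfun_index f e) /\ bounded_fun f].

(** [conbhd c] is N_{I,J} for the pair (I, J) coded by [c]. *)
Definition conbhd (c : nat) : set (R -> R) :=
  [set f | continuous f /\
           f @` compact_itv (unpair1 c) `<=` open_itv (unpair2 c)].

(** [p] enumerates the family of all N_{I,J} containing [f]. *)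
Definition co_name f (p : nat -> nat) : Prop :=
  range (fun n => conbhd (p n)) = conbhd @` [set c | conbhd c f].

(** * Computable measures *)

Definition sigma1_index U (e : nat) : Prop :=
  open U /\ ce_index [set i | open_itv i `<=` U] e.

Definition left_cut_index (x : \bar R) (e : nat) : Prop :=
  ce_index [set n | ((ratr (ratn n))%:E < x)%E] e.

(** Finite Borel measures on the line. *)
Definition finmeas := {finite_measure set (measurableTypeR R) -> \bar R}.

(** An index of [mu] packs an index of the real mu(R) and an index of a
    procedure mapping indices of open sets U to indices of the left cuts
    of mu(U). *)
Definition measure_index (mu : finmeas) (e : nat) : Prop :=
  real_index (fine (mu setT)) (unpair1 e) /\
  forall U i, sigma1_index U i ->
    exists2 j, phi (unpair2 e) i j & left_cut_index (mu U) j.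

Definition uniformly_computable (mu_ : nat -> finmeas) : Prop :=
  exists2 h, computable h & forall n, measure_index (mu_ n) (h n).

(** * Effective weak convergence *)

Definition integral_of (mu : finmeas) f : R := (\int[mu]_x f x)%R.

Definition is_modulus (u : nat -> R) l (g : nat -> nat) : Prop :=
  forall k n, (g k <= n)%N -> `|u n - l| < 2 ^- k.

Definition weakly_converges (mu_ : nat -> finmeas) (mu : finmeas) : Prop :=
  forall f, Cb f ->
    integral_of (mu_ n) f @[n --> \oo] --> integral_of mu f.

Definition effectively_weakly_converges
    (mu_ : nat -> finmeas) (mu : finmeas) : Prop :=
  (forall f, Cbc f ->
     integral_of (mu_ n) f @[n --> \oo] --> integral_of mu f) /\
  exists e, forall f i B,
    Cbc f -> realfun_index f i -> (forall x, `|f x| <= B%:R) ->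
    exists2 m, phi e <| i, B |> m &
    exists2 g, is_modulus (fun n => integral_of (mu_ n) f)
                          (integral_of mu f) g &
               fun_index g m.

Definition uniformly_effectively_weakly_converges
    (mu_ : nat -> finmeas) (mu : finmeas) : Prop :=
  weakly_converges mu_ mu /\
  exists e, forall f p B,
    Cb f -> co_name f p -> (forall x, `|f x| <= B%:R) ->
    exists2 g, is_modulus (fun n => integral_of (mu_ n) f)
                          (integral_of mu f) g &
               forall k, Phi e p <| B, k |> (g k).

End Reals.

(* Main.v *)
(** Given an index [i] of a computable function [f], the inclusion of f[I] in J
    is semi-decidable: by compactness it is witnessed by a finite grid of I
    together with, for each cell, a finite piece of Cauchy name on which the
    [i]-th functional halts with an output well inside J.  So a compact-open
    name of [f] is computable from [i], and uniform effective weak convergence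
    implies effective weak convergence.

    Conversely, fix a precision 2^-K.  A witness found by unbounded search
    consists of [N] and [n0] such that mu_n0 has mass less than 2^-K outside
    of ]-N, N[ (a semi-decidable condition since the measures are uniformly
    computable), with [n0] beyond a modulus for the piecewise linear function
    [tail N], which vanishes on [-N, N] and is 1 off [-(N+1), N+1]; and of a
    rational polygon psi that the compact-open name of [f] shows to be
    2^-K-close to [f] on [-(N+1), N+1].  The integrals of [tail N] against mu_n
    are then small for all n >= n0, the modulus for psi is known by hypothesis,
    and [integral_of_dist] turns |f - psi| <= 2^-K + B tail N into a modulus
    for [f]. *)

Require Import Defs.
From Stdlib Require Cantor.
From mathcomp Require Import all_boot all_order all_algebra.
From mathcomp Require Import all_classical all_reals all_analysis.
From mathcomp Require Import measurable_realfun zify ring lra.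

Set Implicit Arguments.
Unset Strict Implicit.
Unset Printing Implicit Defensive.

Import Order.TTheory GRing.Theory Num.Theory.
Import numFieldNormedType.Exports.

Local Open Scope classical_set_scope.
Local Open Scope nat_scope.
Local Notation eval := Defs.eval.

Opaque Cantor.to_nat Cantor.of_nat.

(** * Computable functionals *)

(** A compact-open name says nothing about [f] near infinity, and [f] itself has no index to which
    effective convergence could be applied. A polygon has an index computable from its data, so it
    can stand for [f] on a bounded interval; the tails must be controlled separately, and nothing
    effective is known about mu itself. The test therefore looks at one measure mu_n0, whose index
    is available, and the modulus for [tail N] carries the estimate to the limit and back to all
    later measures. A common bound [C] on the masses is a constant built into the algorithm; it is
    shown to exist, not computed. The modulus is correct for every name of [f], computable or not,
    so weak convergence on all of [Cb] follows by feeding in some name. The universal machine takes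
    a partial oracle because semi-deciding f[I] in J runs a functional on finite pieces of names;
    with the zero oracle it also simulates the given indices inside the search. *)

Lemma unpair1K a b : unpair1 <|a, b|> = a.
Proof. by rewrite /unpair1 Cantor.cancel_of_to. Qed.

Lemma unpair2K a b : unpair2 <|a, b|> = b.
Proof. by rewrite /unpair2 Cantor.cancel_of_to. Qed.

Lemma unpairK n : <|unpair1 n, unpair2 n|> = n.
Proof.
by rewrite /unpair1 /unpair2 -surjective_pairing Cantor.cancel_to_of.
Qed.

Opaque unpair1 unpair2.

Definition unpairE := (unpair1K, unpair2K).

(** Totality for every oracle is built in, so closure properties can be applied by syntax alone;
    unbounded search is added separately in [eff_search] and [eff_ce]. *)
Definition eff (F : (nat -> nat) -> nat -> nat) : Prop :=
  exists c, forall p n, eval p c n (F p n).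

Lemma eff_ext F G : (forall p n, F p n = G p n) -> eff G -> eff F.
Proof. by move=> FG [c cP]; exists c => p n; rewrite FG. Qed.

Lemma eff_id : eff (fun _ n => n).
Proof.
exists (CPair CFst CSnd) => p n /=.
by exists (unpair1 n), (unpair2 n); split=> //; rewrite unpairK.
Qed.

Lemma eff_zero : eff (fun _ _ => 0).
Proof. by exists CZero. Qed.

Lemma eff_comp F G : eff F -> eff G -> eff (fun p n => F p (G p n)).
Proof. by move=> [f fP] [g gP]; exists (CComp f g) => p n; exists (G p n). Qed.

Lemma eff_succ X : eff X -> eff (fun p n => (X p n).+1).
Proof. by apply: (@eff_comp (fun _ n => n.+1)); exists CSucc. Qed.

Lemma eff_const k : eff (fun _ _ => k).
Proof. by elim: k => [|k IH]; [exact: eff_zero|exact: (eff_succ IH)]. Qed.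

Lemma eff_unpair1 X : eff X -> eff (fun p n => unpair1 (X p n)).
Proof. by apply: (@eff_comp (fun _ n => unpair1 n)); exists CFst. Qed.

Lemma eff_unpair2 X : eff X -> eff (fun p n => unpair2 (X p n)).
Proof. by apply: (@eff_comp (fun _ n => unpair2 n)); exists CSnd. Qed.

Lemma eff_oracle X : eff X -> eff (fun p n => p (X p n)).
Proof. by apply: (@eff_comp (fun p n => p n)); exists COracle. Qed.

Lemma eff_pair X Y : eff X -> eff Y -> eff (fun p n => <|X p n, Y p n|>).
Proof.
move=> [x xP] [y yP]; exists (CPair x y) => p n /=.
by exists (X p n), (Y p n).
Qed.

Lemma eff_iteri N G A :
    eff N ->
    eff (fun p n => G p (unpair1 n) (unpair1 (unpair2 n)) (unpair2 (unpair2 n))) ->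
    eff A ->
  eff (fun p n => iteri (N p n) (G p n) (A p n)).
Proof.
move=> [d dP] [g gP] [a aP].
(* [CPair CFst CSnd] is the identity: the recursion keeps the whole input as its parameter, so base
   and step may depend on it. *)
exists (CComp (CPrec a g) (CPair (CPair CFst CSnd) d)) => p n /=.
exists <|n, N p n|>.
  exists n, (N p n); split=> //; exists (unpair1 n), (unpair2 n).
  by split=> //; rewrite unpairK.
rewrite unpair1K unpair2K.
elim: (N p n) => [|k IH] //=; exists (iteri k (G p n) (A p n)) => //.
by have := gP p <|n, <|k, iteri k (G p n) (A p n)|> |>; rewrite !unpairE.
Qed.

(* Redefined each time that closure properties become available. *)
Ltac eff_ext := fail.
Ltac eff_step :=
  lazymatch goal with
  | H : eff ?F |- eff ?F => exact H
  | |- eff (fun p n => n) => exact: eff_id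
  | |- eff (fun _ _ => ?k) => exact: (eff_const k)
  | |- eff (fun p n => _.+1) => apply: eff_succ
  | |- eff (fun p n => unpair1 _) => apply: eff_unpair1
  | |- eff (fun p n => unpair2 _) => apply: eff_unpair2
  | |- eff (fun p n => Cantor.to_nat _) => apply: eff_pair
  | |- eff (fun p n => iteri _ _ _) => apply: eff_iteri
  | H : eff ?F |- eff (fun p n => ?F p (@?G p n)) =>
      apply: (eff_comp (F := F) H)
  | H : eff (fun p n => nat_of_bool (?F p n))
    |- eff (fun p n => nat_of_bool (?F p (@?G p n))) =>
      apply: (eff_comp (F := fun p n => nat_of_bool (F p n)) H)
  | |- eff (fun p n => p _) => apply: eff_oracle
  | _ => eff_ext
  end.
Ltac eff := repeat eff_step.

Lemma eff_pred X : eff X -> eff (fun p n => (X p n).-1).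
Proof.
move=> eX; apply: (@eff_ext _ (fun p n => iteri (X p n) (fun i _ => i) 0)).
  by move=> p n; case: (X p n).
eff.
Qed.

Ltac eff_ext ::=
  lazymatch goal with |- eff (fun p n => _.-1) => apply: eff_pred end.

Lemma eff_add X Y : eff X -> eff Y -> eff (fun p n => X p n + Y p n).
Proof.
move=> eX eY.
apply: (@eff_ext _ (fun p n => iteri (Y p n) (fun _ r => r.+1) (X p n))).
  by move=> p n; elim: (Y p n) => [|y IH] /=; rewrite ?addn0 // addnS IH.
eff.
Qed.

Lemma eff_sub X Y : eff X -> eff Y -> eff (fun p n => X p n - Y p n).
Proof.
move=> eX eY.
apply: (@eff_ext _ (fun p n => iteri (Y p n) (fun _ r => r.-1) (X p n))).
  by move=> p n; elim: (Y p n) => [|y IH] /=; rewrite ?subn0 // subnS IH.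
eff.
Qed.

Lemma eff_mul X Y : eff X -> eff Y -> eff (fun p n => X p n * Y p n).
Proof.
move=> eX eY.
apply: (@eff_ext _ (fun p n => iteri (Y p n) (fun _ r => r + X p n) 0)).
  by move=> p n; elim: (Y p n) => [|y IH] /=; rewrite ?muln0 // mulnS -IH addnC.
by eff; apply: eff_add; eff.
Qed.

Ltac eff_arith :=
  lazymatch goal with
  | |- eff (fun p n => _.-1) => apply: eff_pred
  | |- eff (fun p n => _ + _) => apply: eff_add
  | |- eff (fun p n => _ - _) => apply: eff_sub
  | |- eff (fun p n => _ * _) => apply: eff_mul
  end.
Ltac eff_ext ::= eff_arith.

Lemma eff_exp X Y : eff X -> eff Y -> eff (fun p n => X p n ^ Y p n).
Proof.
move=> eX eY.
apply: (@eff_ext _ (fun p n => iteri (Y p n) (fun _ r => X p n * r) 1)).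
  by move=> p n; elim: (Y p n) => [|y IH] //=; rewrite expnS IH.
eff.
Qed.

Lemma eff_if (b : (nat -> nat) -> nat -> bool) X Y :
  eff b -> eff X -> eff Y -> eff (fun p n => if b p n then X p n else Y p n).
Proof.
move=> eb eX eY.
apply: (@eff_ext _ (fun p n => iteri (b p n) (fun _ _ => X p n) (Y p n))).
  by move=> p n; case: (b p n).
eff.
Qed.

Lemma eff_leq X Y : eff X -> eff Y -> eff (fun p n => X p n <= Y p n).
Proof.
move=> eX eY.
apply: (@eff_ext _ (fun p n => 1 - (X p n - Y p n))); first by move=> p n; lia.
eff.
Qed.

Lemma eff_negb (b : (nat -> nat) -> nat -> bool) :
  eff b -> eff (fun p n => ~~ b p n).
Proof.
move=> eb; apply: (@eff_ext _ (fun p n => 1 - b p n)); first by move=> p n; lia.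
eff.
Qed.

Lemma eff_andb (b d : (nat -> nat) -> nat -> bool) :
  eff b -> eff d -> eff (fun p n => b p n && d p n).
Proof.
move=> eb ed; apply: (@eff_ext _ (fun p n => b p n * d p n)).
  by move=> p n; case: (b p n) (d p n) => [] [].
eff.
Qed.

Lemma eff_eq X Y : eff X -> eff Y -> eff (fun p n => X p n == Y p n).
Proof.
move=> eX eY.
apply: (@eff_ext _ (fun p n => (X p n <= Y p n) && (Y p n <= X p n))).
  by move=> p n; rewrite eqn_leq.
by apply: eff_andb; apply: eff_leq.
Qed.

Ltac eff_bool :=
  lazymatch goal with
  | |- eff (fun p n => _ ^ _) => apply: eff_exp
  | |- eff (fun p n => if _ then _ else _) => apply: eff_if
  | |- eff (fun p n => nat_of_bool (_ <= _)) => apply: eff_leq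
  | |- eff (fun p n => nat_of_bool (negb _)) => apply: eff_negb
  | |- eff (fun p n => nat_of_bool (_ && _)) => apply: eff_andb
  | |- eff (fun p n => nat_of_bool (_ == _)) => apply: eff_eq
  | _ => eff_arith
  end.
Ltac eff_ext ::= eff_bool.

Lemma eff_all (P : (nat -> nat) -> nat -> nat -> bool) N :
    eff N -> eff (fun p n => P p (unpair1 n) (unpair2 n)) ->
  eff (fun p n => all (P p n) (iota 0 (N p n))).
Proof.
move=> eN eP.
have eP' : eff (fun p n => P p (unpair1 n) (unpair1 (unpair2 n))).
  apply: (@eff_ext _ (fun p n => P p (unpair1 (<|unpair1 n, unpair1 (unpair2 n)|>))
     (unpair2 (<|unpair1 n, unpair1 (unpair2 n)|>)))) => [p n|].
    by rewrite !unpairE.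
  by apply: (eff_comp eP); eff.
apply: (@eff_ext _ (fun p n => iteri (N p n) (fun i r => if P p n i then r else 0) 1)).
  move=> p n; elim: (N p n) => [|m IH] //.
  rewrite -{1}addn1 iotaD all_cat /= -IH andbT add0n.
  by case: (all _ _) (P p n m) => [] [].
eff.
Qed.

(** Serves to decode indices: [encode] sends the four composite constructors to 5 + r + 4 * q with r
    < 4. *)
Lemma eff_div4 X : eff X -> eff (fun p n => X p n %/ 4).
Proof.
move=> eX.
apply: (@eff_ext _ (fun p n => iteri (X p n) (fun i r => if r.+1 * 4 <= i.+1 then r.+1 else r) 0)).
  move=> p n; elim: (X p n) => [|m IH] //=.
  by rewrite -IH; case: ifP; lia.
eff.
Qed.

Lemma eff_mod4 X : eff X -> eff (fun p n => X p n %% 4).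
Proof.
move=> eX; apply: (@eff_ext _ (fun p n => X p n - X p n %/ 4 * 4)).
  by move=> p n; rewrite {2}(divn_eq (X p n) 4) addnC addnK.
by eff; apply: eff_div4.
Qed.

Ltac eff_div :=
  lazymatch goal with
  | |- eff (fun p n => _ %/ 4) => refine (eff_div4 _)
  | |- eff (fun p n => _ %% 4) => refine (eff_mod4 _)
  | |- eff (fun p n => nat_of_bool (all _ (iota 0 _))) => apply: eff_all
  | _ => eff_bool
  end.
Ltac eff_ext ::= eff_div.

(** * A universal stack machine *)

Lemma eff_iter N (G : (nat -> nat) -> nat -> nat -> nat) A :
    eff N -> eff (fun p n => G p (unpair1 n) (unpair2 n)) -> eff A ->
  eff (fun p n => iter (N p n) (G p n) (A p n)).
Proof.
move=> eN eG eA.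
have eG' : eff (fun p n => G p (unpair1 n) (unpair2 (unpair2 n))).
  apply: (@eff_ext _ (fun p n =>
    (fun p n => G p (unpair1 n) (unpair2 n)) p
       <|unpair1 n, unpair2 (unpair2 n)|>)) => [p n|].
    by rewrite !unpairE.
  by apply: (eff_comp eG); eff.
apply: (@eff_ext _ (fun p n => iteri (N p n) (fun _ => G p n) (A p n))).
  by move=> p n; elim: (N p n) => //= m ->.
eff.
Qed.

Ltac eff_iterate :=
  lazymatch goal with
  | |- eff (fun p n => iter _ _ _) => apply: eff_iter
  | _ => eff_div
  end.
Ltac eff_ext ::= eff_iterate.

(** A number is read as an infinite list with head [unpair1] and tail [unpair2]; no length is
    stored, so callers keep it separately. *)
Definition nthc (l j : nat) : nat := unpair1 (iter j unpair2 l).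

Lemma eff_nthc X Y : eff X -> eff Y -> eff (fun p n => nthc (X p n) (Y p n)).
Proof. by rewrite /nthc => eX eY; eff. Qed.

Lemma nthc_surj (f : nat -> nat) m : exists l, forall j, j < m -> nthc l j = f j.
Proof.
elim: m f => [|m IH] f; first by exists 0.
have [l lP] := IH (fun j => f j.+1).
exists <|f 0, l|> => -[|j] jm; first by rewrite /nthc /= unpairE.
by rewrite /nthc iterSr unpairE; exact: lP.
Qed.

(** A stack machine evaluating codes.  The state is <|<|0, v|>, K|> when the
    value [v] is returned to the stack [K], and <|<|i.+1, n|>, K|> when the
    code with index [i] is to be run on [n].  The oracle is partial: [o n] is
    [0] if undefined, and otherwise the successor of the answer; an undefined
    query blocks the machine.  Stack frames carry the tag [0] or [1] (first and
    second half of [CPair]), [2] ([CComp]), [3] ([CPrec]) or [4] ([CMu]). *)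
Definition ret (v K : nat) : nat := <|<|0, v|>, K|>.
Definition ev (i n K : nat) : nat := <|<|i.+1, n|>, K|>.
Definition push (t d K : nat) : nat := <|<|t, d|>, K|>.+1.

Definition step_frame (t d v K : nat) : nat :=
  if t == 0 then ev (unpair1 d) (unpair2 d) (push 1 v K)
  else if t == 1 then ret <|d, v|> K
  else if t == 2 then ev d v K
  else if t == 3 then
    if unpair1 (unpair2 d) == unpair2 (unpair2 d) then ret v K
    else ev (unpair1 (unpair1 d))
            <|unpair2 (unpair1 d), <|unpair1 (unpair2 d), v|> |>
            (push 3 <|unpair1 d,
                      <|(unpair1 (unpair2 d)).+1, unpair2 (unpair2 d)|> |> K)
  else if v == 0 then ret (unpair2 d) K
  else ev (unpair1 (unpair1 d)) <|unpair2 (unpair1 d), (unpair2 d).+1|>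
          (push 4 <|unpair1 d, (unpair2 d).+1|> K).

Definition step_code (r q n K : nat) : nat :=
  if r == 0 then ev (unpair1 q) n (push 0 <|unpair2 q, n|> K)
  else if r == 1 then ev (unpair2 q) n (push 2 (unpair1 q) K)
  else if r == 2 then
    ev (unpair1 q) (unpair1 n)
       (push 3 <|<|unpair2 q, unpair1 n|>, <|0, unpair2 n|> |> K)
  else ev q <|n, 0|> (push 4 <|<|q, n|>, 0|> K).

Definition step_ev (o : nat -> nat) (i n K : nat) : nat :=
  if i == 0 then ret 0 K
  else if i == 1 then ret n.+1 K
  else if i == 2 then ret (unpair1 n) K
  else if i == 3 then ret (unpair2 n) K
  else if i == 4 then if o n == 0 then ev i n K else ret (o n).-1 K
  else step_code ((i - 5) %% 4) ((i - 5) %/ 4) n K.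

Definition step_ret (v K : nat) : nat :=
  if K == 0 then ret v K
  else step_frame (unpair1 (unpair1 K.-1)) (unpair2 (unpair1 K.-1)) v
                  (unpair2 K.-1).

Definition step (o : nat -> nat) (st : nat) : nat :=
  if unpair1 (unpair1 st) == 0 then step_ret (unpair2 (unpair1 st)) (unpair2 st)
  else step_ev o (unpair1 (unpair1 st)).-1 (unpair2 (unpair1 st)) (unpair2 st).

Lemma step_evE o i n K : step o (ev i n K) = step_ev o i n K.
Proof. by rewrite /step /ev !unpairE. Qed.

Lemma step_retE o v t d K : step o (ret v (push t d K)) = step_frame t d v K.
Proof. by rewrite /step /ret !unpairE /step_ret /push /= !unpairE. Qed.

Lemma step_ret0 o v : step o (ret v 0) = ret v 0.
Proof. by rewrite /step /ret !unpairE. Qed.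

Lemma iter_ret0 o s v : iter s (step o) (ret v 0) = ret v 0.
Proof. by elim: s => //= s ->; exact: step_ret0. Qed.

Lemma ret_inj v v' K K' : ret v K = ret v' K' -> v = v'.
Proof.
by move=> /(congr1 (fun x => unpair2 (unpair1 x))); rewrite /ret !unpairE.
Qed.

Lemma ev_neq_ret i n K v K' : ev i n K <> ret v K'.
Proof. by move=> /(congr1 (fun x => unpair1 (unpair1 x))); rewrite !unpairE. Qed.

Lemma push_neq0 v t d K v' : ret v (push t d K) <> ret v' 0.
Proof. by move=> /(congr1 unpair2); rewrite /ret /push !unpairE. Qed.

Lemma halt_uniq o s s' st v v' :
  iter s (step o) st = ret v 0 -> iter s' (step o) st = ret v' 0 -> v = v'.
Proof.
wlog ss : s s' v v' / s <= s' => [W sv sv'|sv].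
  by case: (leqP s s') => [/W|/ltnW /W]; [exact|move=> e; apply/esym/e].
by rewrite -(subnK ss) iterD sv iter_ret0 => /ret_inj.
Qed.

Lemma encodeE (f g : Defs.code) :
  [/\ (encode (CPair f g) - 5) %% 4 = 0,
      (encode (CComp f g) - 5) %% 4 = 1,
      (encode (CPrec f g) - 5) %% 4 = 2 &
      (encode (CMu f) - 5) %% 4 = 3] /\
  [/\ (encode (CPair f g) - 5) %/ 4 = <|encode f, encode g|>,
      (encode (CComp f g) - 5) %/ 4 = <|encode f, encode g|>,
      (encode (CPrec f g) - 5) %/ 4 = <|encode f, encode g|> &
      (encode (CMu f) - 5) %/ 4 = encode f].
Proof.
rewrite /=; move: <|_, _|> => x; move: (encode f) => y.
by split; split; lia.
Qed.

Lemma step_ev_big o i n K : 5 <= i ->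
  step_ev o i n K = step_code ((i - 5) %% 4) ((i - 5) %/ 4) n K.
Proof. by move: i => [|[|[|[|[|i]]]]]. Qed.

Lemma step_pair o (f g : Defs.code) n K : step o (ev (encode (CPair f g)) n K) =
  ev (encode f) n (push 0 <|encode g, n|> K).
Proof.
have [[e _ _ _] [q _ _ _]] := encodeE f g.
by rewrite step_evE step_ev_big // e q /step_code /= !unpairE.
Qed.

Lemma step_comp o (f g : Defs.code) n K : step o (ev (encode (CComp f g)) n K) =
  ev (encode g) n (push 2 (encode f) K).
Proof.
have [[_ e _ _] [_ q _ _]] := encodeE f g.
by rewrite step_evE step_ev_big // e q /step_code /= ?unpairE.
Qed.

Lemma step_prec o (f g : Defs.code) n K : step o (ev (encode (CPrec f g)) n K) =
  ev (encode f) (unpair1 n)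
     (push 3 <|<|encode g, unpair1 n|>, <|0, unpair2 n|> |> K).
Proof.
have [[_ _ e _] [_ _ q _]] := encodeE f g.
by rewrite step_evE step_ev_big // e q /step_code /= ?unpairE.
Qed.

Lemma step_mu o (f : Defs.code) n K : step o (ev (encode (CMu f)) n K) =
  ev (encode f) <|n, 0|> (push 4 <|<|encode f, n|>, 0|> K).
Proof.
have [[_ _ _ e] [_ _ _ q]] := encodeE f f.
by rewrite step_evE step_ev_big // e q /step_code /= ?unpairE.
Qed.

Lemma step_prec_end o v ga k K :
  step o (ret v (push 3 <|ga, <|k, k|> |> K)) = ret v K.
Proof. by rewrite step_retE /step_frame /= !unpairE eqxx. Qed.

Lemma step_prec_next o v g a k l K : k < l ->
  step o (ret v (push 3 <|<|g, a|>, <|k, l|> |> K)) =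
  ev g <|a, <|k, v|> |> (push 3 <|<|g, a|>, <|k.+1, l|> |> K).
Proof. by move=> kl; rewrite step_retE /step_frame /= !unpairE ltn_eqF. Qed.

Lemma step_mu_next o v f n i K :
  step o (ret v.+1 (push 4 <|<|f, n|>, i|> K)) =
  ev f <|n, i.+1|> (push 4 <|<|f, n|>, i.+1|> K).
Proof. by rewrite step_retE /step_frame /= !unpairE. Qed.

Definition reaches (o : nat -> nat) (st st' : nat) : Prop :=
  exists s, iter s (step o) st = st'.

Lemma reaches_refl o st : reaches o st st.
Proof. by exists 0. Qed.

Lemma reaches_trans o st2 st1 st3 :
  reaches o st1 st2 -> reaches o st2 st3 -> reaches o st1 st3.
Proof. by move=> [s sP] [s' s'P]; exists (s' + s); rewrite iterD sP. Qed.

Lemma reaches_step o st st' : reaches o (step o st) st' -> reaches o st st'.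
Proof. by apply: reaches_trans; exists 1. Qed.

(** The stack [K] is arbitrary so that the induction on [c] can run a subcode on top of the frames
    pushed by the enclosing code. *)
Lemma machine_complete p o c n m K : (forall n, o n = (p n).+1) ->
  eval p c n m -> reaches o (ev (encode c) n K) (ret m K).
Proof.
move=> oP; elim: c n m K => /=.
- by move=> n _ K ->; exists 1; rewrite /= step_evE.
- by move=> n _ K ->; exists 1; rewrite /= step_evE.
- by move=> n _ K ->; exists 1; rewrite /= step_evE.
- by move=> n _ K ->; exists 1; rewrite /= step_evE.
- by move=> n _ K ->; exists 1; rewrite /= step_evE /step_ev /= oP.
- move=> f IHf g IHg n _ K [a [b [fa gb ->]]].
  apply: reaches_step; rewrite step_pair.
  apply: reaches_trans (IHf _ _ _ fa) _.
  apply: reaches_step; rewrite step_retE /step_frame /= !unpairE.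
  apply: reaches_trans (IHg _ _ _ gb) _.
  by apply: reaches_step; rewrite step_retE; exact: reaches_refl.
- move=> f IHf g IHg n m K [r gr fm].
  apply: reaches_step; rewrite step_comp.
  apply: reaches_trans (IHg _ _ _ gr) _.
  apply: reaches_step; rewrite step_retE /step_frame /=.
  exact: IHf.
- move=> f IHf g IHg n m K; set a := unpair1 n; set l := unpair2 n => gm.
  apply: reaches_step; rewrite step_prec -/a -/l.
  suff H k r : k <= l -> prec_graph (eval p f) (eval p g) a k r ->
      reaches o (ev (encode f) a (push 3 <|<|encode g, a|>, <|0, l|> |> K))
                (ret r (push 3 <|<|encode g, a|>, <|k, l|> |> K)).
    apply: reaches_trans (H l m (leqnn l) gm) _.
    by apply: reaches_step; rewrite step_prec_end; exact: reaches_refl.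
  elim: k r => [|k IH] r kl /=; first exact: IHf.
  move=> [r' fr' gr]; apply: reaches_trans (IH _ (ltnW kl) fr') _.
  by apply: reaches_step; rewrite step_prec_next //; exact: IHg.
- move=> f IHf n m K [f0 fS].
  apply: reaches_step; rewrite step_mu //.
  suff H i : i <= m ->
      reaches o (ev (encode f) <|n, 0|> (push 4 <|<|encode f, n|>, 0|> K))
                (ev (encode f) <|n, i|> (push 4 <|<|encode f, n|>, i|> K)).
    apply: reaches_trans (H m (leqnn m)) _.
    apply: reaches_trans (IHf _ _ _ f0) _.
    apply: reaches_step; rewrite step_retE /step_frame /= !unpairE.
    exact: reaches_refl.
  elim: i => [|i IH] im; first exact: reaches_refl.
  apply: reaches_trans (IH (ltnW im)) _.
  have [v fv] := fS _ im.
  apply: reaches_trans (IHf _ _ _ fv) _.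
  by apply: reaches_step; rewrite step_mu_next; exact: reaches_refl.
Qed.

(** A run that empties the stack must first return a value to [K], and it does so in strictly fewer
    steps. The induction is on the number of steps, since recursion and minimization run the same
    subcode repeatedly. *)
Lemma machine_sound p o c n K v s : (forall n, o n = (p n).+1) ->
  iter s (step o) (ev (encode c) n K) = ret v 0 ->
  exists m s', [/\ s' < s, eval p c n m & iter s' (step o) (ret m K) = ret v 0].
Proof.
move=> oP; elim/ltn_ind: s c n K => -[_ c n K /ev_neq_ret //|s IH] c n K.
have {}IH c' n' K' s' : s' <= s ->
    iter s' (step o) (ev (encode c') n' K') = ret v 0 ->
    exists m s'', [/\ s'' < s', eval p c' n' m &
                      iter s'' (step o) (ret m K') = ret v 0].
  by move=> s's; apply: IH; rewrite ltnS.
rewrite iterSr; case: c => [||||| f g | f g | f g | f].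
- by rewrite step_evE => E; exists 0, s.
- by rewrite step_evE => E; exists n.+1, s.
- by rewrite step_evE => E; exists (unpair1 n), s.
- by rewrite step_evE => E; exists (unpair2 n), s.
- by rewrite step_evE /step_ev /= oP => E; exists (p n), s.
- rewrite step_pair => /(IH _ _ _ _ (leqnn s)) [a [[|s1] [s1s fa]]].
    by move=> /push_neq0.
  rewrite iterSr step_retE /step_frame /= !unpairE.
  move=> /(IH _ _ _ _ (ltnW (ltnW s1s))) [b [[|s2] [s2s gb]]].
    by move=> /push_neq0.
  rewrite iterSr step_retE /step_frame /= => E; exists <|a, b|>, s2.
  by split=> //; [lia|exists a, b].
- rewrite step_comp => /(IH _ _ _ _ (leqnn s)) [a [[|s1] [s1s fa]]].
    by move=> /push_neq0.
  rewrite iterSr step_retE /step_frame /=.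
  move=> /(IH _ _ _ _ (ltnW (ltnW s1s))) [b [s2 [s2s gb E]]].
  by exists b, s2; split=> //; [lia|exists a].
- rewrite step_prec /=; set a := unpair1 n; set l := unpair2 n.
  move=> /(IH _ _ _ _ (leqnn s)) [r [s1 [s1s fr]]].
  (* [d] counts the remaining rounds; every round consumes machine steps, so [s'] stays below [s]
     and [IH] remains applicable. *)
  suff H d k r' s' : l - k = d -> k <= l -> s' < s ->
      prec_graph (eval p f) (eval p g) a k r' ->
      iter s' (step o) (ret r' (push 3 <|<|encode g, a|>, <|k, l|> |> K)) =
        ret v 0 ->
      exists m s2, [/\ s2 < s.+1, prec_graph (eval p f) (eval p g) a l m &
                       iter s2 (step o) (ret m K) = ret v 0].
    exact: (H _ 0 r s1 erefl).
  clear r s1 s1s fr; move: r' s' => r s1.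
  elim: d k r s1 => [|d IHd] k r s1 ekl kl s1s fr.
    have {ekl kl} Ek : k = l by lia.
    rewrite Ek in fr *.
    case: s1 s1s => [_ /push_neq0 //|s1 s1s].
    by rewrite iterSr step_prec_end => E; exists r, s1; split=> //; lia.
  case: s1 s1s => [_ /push_neq0 //|s1 s1s].
  rewrite iterSr step_prec_next; last by lia.
  move=> /(IH _ _ _ _ (ltnW (ltnW s1s))) [b [s2 [s2s gb]]].
  by apply: (IHd k.+1); [lia|lia|lia|exists r].
- rewrite step_mu // => /(IH _ _ _ _ (leqnn s)) [r [s1 [s1s fr]]].
  (* The search has no bound known in advance, so this induction is on the steps left, carrying the
     nonzero values already seen. *)
  suff H s' k r' : eval p f <|n, k|> r' -> s' < s ->
      (forall i, i < k -> exists w, eval p f <|n, i|> w.+1) ->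
      iter s' (step o) (ret r' (push 4 <|<|encode f, n|>, k|> K)) = ret v 0 ->
      exists m s2, [/\ s2 < s.+1, eval p (CMu f) n m &
                       iter s2 (step o) (ret m K) = ret v 0].
    exact: (H s1 0 r).
  clear r s1 s1s fr; move: s' r' => s1 r.
  elim/ltn_ind: s1 k r => s1 IHs k r fr s1s below.
  case: s1 s1s IHs => [_ _ /push_neq0 //|s1 s1s IHs].
  case: r fr => [fk|r fr].
    rewrite iterSr step_retE /step_frame /= !unpairE => E; exists k, s1.
    by split=> //; lia.
  rewrite iterSr step_mu_next.
  move=> /(IH _ _ _ _ (ltnW (ltnW s1s))) [b [s2 [s2s gb]]].
  apply: (IHs s2 _ k.+1) => //; [lia|lia|move=> i].
  by rewrite ltnS leq_eqVlt => /orP[/eqP ->|]; [exists r|exact: below].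
Qed.

Lemma encode_surj i : exists c, encode c = i.
Proof.
have le_pair q : unpair1 q <= q /\ unpair2 q <= q.
  rewrite -{2 4}(unpairK q).
  by have := Cantor.to_nat_non_decreasing (unpair1 q) (unpair2 q); lia.
elim/ltn_ind: i => -[|[|[|[|[|i]]]]] IH.
- by exists CZero.
- by exists CSucc.
- by exists CFst.
- by exists CSnd.
- by exists COracle.
have [le1 le2] := le_pair (i %/ 4).
have [|f fP] := IH (unpair1 (i %/ 4)); first by lia.
have [|g gP] := IH (unpair2 (i %/ 4)); first by lia.
have [|h hP] := IH (i %/ 4); first by lia.
have := divn_eq i 4; have : i %% 4 < 4 by rewrite ltn_mod.
case: (i %% 4) => [|[|[|[|//]]]] _ E.
- by exists (CPair f g); rewrite /= fP gP unpairK; lia.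
- by exists (CComp f g); rewrite /= fP gP unpairK; lia.
- by exists (CPrec f g); rewrite /= fP gP unpairK; lia.
- by exists (CMu h); rewrite /= hP; lia.
Qed.

(** The partial oracle coded by [z]: the zero function if [z = 0], the finite
    list [unpair2 z.-1] of length [unpair1 z.-1] otherwise. *)
Definition orc (z n : nat) : nat :=
  if z == 0 then 1
  else if n < unpair1 z.-1 then (nthc (unpair2 z.-1) n).+1 else 0.

(** [run z s i n] is [v.+1] if the code with index [i] halts on [n] within [s]
    steps with value [v], and [0] otherwise. *)
Definition run (z s i n : nat) : nat :=
  let st := iter s (step (orc z)) (ev i n 0) in
  if (unpair1 (unpair1 st) == 0) && (unpair2 st == 0)
  then (unpair2 (unpair1 st)).+1 else 0.

Lemma runP z s i n v :
  run z s i n = v.+1 <-> iter s (step (orc z)) (ev i n 0) = ret v 0.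
Proof.
rewrite /run; split=> [|->]; last by rewrite /ret !unpairE.
set st := iter _ _ _; case: ifP => // /andP[/eqP e1 /eqP e2] [<-].
by rewrite /ret -[st in LHS]unpairK -[unpair1 st in LHS]unpairK e1 e2.
Qed.

Lemma run_complete i n v : phi i n v -> exists s, run 0 s i n = v.+1.
Proof.
move=> [c <-] /(@machine_complete _ (orc 0) _ _ _ 0 (fun=> erefl)) [s sP].
by exists s; apply/runP.
Qed.

Lemma run_sound s i n v : run 0 s i n = v.+1 -> phi i n v.
Proof.
have [c <-] := encode_surj i; move=> /runP.
move=> /(@machine_sound (fun=> 0) (orc 0) _ _ _ _ _ (fun=> erefl)).
move=> [m [s' [_ cm]]]; rewrite iter_ret0 => /ret_inj <-.
by exists c.
Qed.

Lemma run_monotone z s s' i n v :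
  s <= s' -> run z s i n = v.+1 -> run z s' i n = v.+1.
Proof.
move=> ss /runP E; apply/runP.
by rewrite -(subnK ss) iterD E iter_ret0.
Qed.

Lemma phi_functional i n v v' : phi i n v -> phi i n v' -> v = v'.
Proof.
move=> /run_complete [s /runP sv] /run_complete [s' /runP sv'].
exact: halt_uniq sv sv'.
Qed.

Lemma step_agree o o' st :
  o (unpair2 (unpair1 st)) = o' (unpair2 (unpair1 st)) ->
  step o st = step o' st.
Proof. by rewrite /step /step_ev => ->. Qed.

(** The oracle matters only at a query, where the state has tag 5: the index 4 of [COracle] plus the
    1 that marks an [ev] state. *)
Lemma step_stuck o o' st (n := unpair2 (unpair1 st)) : o n = 0 \/ o n = o' n ->
  step o st = step o' st \/ step o st = st /\ unpair1 (unpair1 st) = 5.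
Proof.
move=> [ o0|/step_agree E]; last by left.
have [e5|n5] := eqVneq (unpair1 (unpair1 st)) 5; [right|left].
  split=> //; rewrite /step e5 /step_ev /= o0 eqxx /ev.
  by rewrite -e5 !unpairK.
rewrite /step /step_ev; case: eqP => // /eqP n0.
suff -> : ((unpair1 (unpair1 st)).-1 == 4) = false by [].
by apply/negbTE; move: n5 n0; case: (unpair1 (unpair1 st)).
Qed.

(** A blocked state is a fixed point and is not a returned value, so a halting run never met an
    unanswered query. *)
Lemma iter_step_sub o o' s st v : (forall n, o n = 0 \/ o n = o' n) ->
  iter s (step o) st = ret v 0 -> iter s (step o') st = ret v 0.
Proof.
move=> oo'; elim: s st => [st H|s IH st]; first exact: H.
have [E|[E e5]] := step_stuck (oo' (unpair2 (unpair1 st))).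
  by rewrite !iterSr E; exact: IH.
have -> : iter s.+1 (step o) st = st.
  by elim: s.+1 => [|k IHk]; [|rewrite iterS IHk].
by move=> Est; move: e5; rewrite Est /ret !unpairE.
Qed.

(** Use principle: one step consults the oracle at most at [unpair2 (unpair1 st)], so finitely many
    steps consult it at finitely many places. *)
Lemma iter_step_use o s st : exists u, forall o',
  (forall n, n < u -> o n = o' n) -> iter s (step o') st = iter s (step o) st.
Proof.
elim: s st => [|s IH] st; first by exists 0.
have [u uP] := IH (step o st).
exists (maxn u (unpair2 (unpair1 st)).+1) => o' oo'.
have E : step o' st = step o st.
  by apply: step_agree; rewrite oo' // leq_max ltnSn orbT.
by rewrite !iterSr E uP // => n nu; rewrite oo' // leq_max nu.
Qed.

Definition extends (z : nat) (p : nat -> nat) : Prop :=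
  forall n, orc z n = 0 \/ orc z n = (p n).+1.

Lemma run_extends z p s i n v w :
  extends z p -> run z s i n = v.+1 -> Phi i p n w -> v = w.
Proof.
move=> zp /runP E [c ci cw].
have {}E := iter_step_sub zp E.
have [s' s'P] := machine_complete 0 (fun n => erefl (p n).+1) cw.
by rewrite ci in s'P; exact: halt_uniq E s'P.
Qed.

Lemma run_use p i n v : Phi i p n v -> exists u s, forall z,
  (forall n, n < u -> orc z n = (p n).+1) -> run z s i n = v.+1.
Proof.
move=> [c <- cv].
have [s sP] := machine_complete 0 (fun n => erefl (p n).+1) cv.
have [u uP] := iter_step_use (fun n => (p n).+1) s (ev (encode c) n 0).
exists u, s => z zp; apply/runP; rewrite -sP; apply: uP => k ku.
by rewrite zp.
Qed.

Lemma eff_step_frame T D V K : eff T -> eff D -> eff V -> eff K ->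
  eff (fun p n => step_frame (T p n) (D p n) (V p n) (K p n)).
Proof. by rewrite /step_frame /ev /ret /push => eT eD eV eK; eff. Qed.

Lemma eff_step_code T D V K : eff T -> eff D -> eff V -> eff K ->
  eff (fun p n => step_code (T p n) (D p n) (V p n) (K p n)).
Proof. by rewrite /step_code /ev /push => eT eD eV eK; eff. Qed.

Lemma eff_orc Z X : eff Z -> eff X -> eff (fun p n => orc (Z p n) (X p n)).
Proof. by rewrite /orc => eZ eX; eff; apply: eff_nthc; eff. Qed.

Ltac eff_machine :=
  lazymatch goal with
  | |- eff (fun p n => nthc _ _) => apply: eff_nthc
  | |- eff (fun p n => step_frame _ _ _ _) => apply: eff_step_frame
  | |- eff (fun p n => step_code _ _ _ _) => apply: eff_step_code
  | |- eff (fun p n => orc _ _) => apply: eff_orc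
  | _ => eff_iterate
  end.
Ltac eff_ext ::= eff_machine.

Lemma eff_step_ev Z I X K : eff Z -> eff I -> eff X -> eff K ->
  eff (fun p n => step_ev (orc (Z p n)) (I p n) (X p n) (K p n)).
Proof. by rewrite /step_ev /ev /ret => eZ eI eX eK; eff. Qed.

Lemma eff_step Z X : eff Z -> eff X ->
  eff (fun p n => step (orc (Z p n)) (X p n)).
Proof. by rewrite /step /step_ret /ret => eZ eX; eff; apply: eff_step_ev; eff. Qed.

Lemma eff_run Z S I X : eff Z -> eff S -> eff I -> eff X ->
  eff (fun p n => run (Z p n) (S p n) (I p n) (X p n)).
Proof. by rewrite /run /ev => eZ eS eI eX; eff; apply: eff_step; eff. Qed.

(** * Effective operations on codes and on rationals *)

(** The code hidden in [Phi] may a priori differ from [c]. The machine sees only their common index: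
    it is complete for the one and sound for the other, which replaces injectivity of [encode]. *)
Lemma Phi_encode p c n m : Phi (encode c) p n m -> eval p c n m.
Proof.
move=> [c' cc' cm]; pose o n := (p n).+1.
have [s sP] := machine_complete 0 (fun n => erefl (o n)) cm.
rewrite cc' in sP; have [m' [s' [_ cm']]] := machine_sound (fun n => erefl (o n)) sP.
by rewrite iter_ret0 => /ret_inj <-.
Qed.

Lemma eff_phi F : eff F -> exists e, forall p n, Phi e p n (F p n).
Proof. by move=> [c cP]; exists (encode c) => p n; exists c. Qed.

Lemma code_smn : exists2 s : nat -> nat -> nat,
  eff (fun _ n => s (unpair1 n) (unpair2 n)) &
  forall c a, exists2 d, encode d = s (encode c) a &
    forall p n m, eval p d n m <-> eval p c <|a, n|> m.
Proof.
pose K a := iter a (CComp CSucc) CZero.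
have K_eval p a n m : eval p (K a) n m <-> m = a.
  elim: a m => [|a IH] m //=; split=> [[r /IH -> ->] //|->].
  by exists a => //; exact/IH.
have K_encode a : encode (K a) = iter a (fun r => 6 + 4 * <|1, r|>) 0.
  by elim: a => //= a ->.
pose d c a := CComp c (CPair (K a) (CPair CFst CSnd)).
(* This is the arithmetic of [encode (d c a)]: 6 and 5 are the offsets of [CComp] and [CPair], while
   1 and 0 are the indices of [CSucc] and [CZero] in [K a]. *)
exists (fun i a => 6 + 4 * <|i, 5 + 4 *
    <|iter a (fun r => 6 + 4 * <|1, r|>) 0, encode (CPair CFst CSnd)|> |>).
  by eff.
move=> c a; exists (d c a) => [|p n m]; first by rewrite -K_encode.
split=> /= [[r]|cm].
  move=> [x [y [/K_eval -> [x' [y' [-> ->]]] -> ->]]].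
  by rewrite unpairK.
exists <|a, n|> => //; exists a, n; split=> //; first exact/K_eval.
by exists (unpair1 n), (unpair2 n); rewrite unpairK.
Qed.

Lemma eff_smn F : eff F -> exists2 s : nat -> nat, eff (fun _ a => s a) &
  forall a p n, Phi (s a) p n (F p <|a, n|>).
Proof.
move=> [c cP]; have [s es sP] := code_smn.
exists (s (encode c)) => [|a p n].
  by apply: eff_ext (eff_comp es (eff_pair (eff_const (encode c)) eff_id)) => p n;
     rewrite !unpairE.
by have [d <- dP] := sP c a; exists d => //; exact/dP/cP.
Qed.

(** Minimization finds the least witness; [F] reads it together with the input, so one search can
    return a value computed from all components of the witness. *)
Lemma eff_search (P : (nat -> nat) -> nat -> nat -> bool)
    (F : (nat -> nat) -> nat -> nat) :
    eff (fun p n => P p (unpair1 n) (unpair2 n)) -> eff F ->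
  exists e, forall p n, (exists w, P p n w) ->
    exists2 w, P p n w & Phi e p n (F p <|n, w|>).
Proof.
move=> eP [f fP].
have [|c cP] := @eff_negb (fun p n => P p (unpair1 n) (unpair2 n)).
  exact: eP.
exists (encode (CComp f (CPair (CPair CFst CSnd) (CMu c)))) => p n exw.
have [w Pw w_min] := ex_minnP exw; exists w => //.
eexists; first by [].
exists <|n, w|> => //; exists n, w; split=> //.
  by exists (unpair1 n), (unpair2 n); rewrite unpairK.
split=> [|i iw].
  by have := cP p <|n, w|>; rewrite !unpairE Pw.
exists 0; have := cP p <|n, i|>; rewrite !unpairE.
by case: (boolP (P p n i)) => // /w_min; rewrite leqNgt iw.
Qed.

Lemma eff_ce (P : nat -> nat -> bool) :
    eff (fun _ n => P (unpair1 n) (unpair2 n)) ->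
  exists2 s : nat -> nat, eff (fun _ a => s a) &
    forall a, ce_index [set n | P a n] (s a).
Proof.
(* The negated test ignores the search variable, so [CMu c] stops at 0 if the property holds and
   diverges otherwise. *)
move=> eP; have [|c cP] := @eff_negb (fun _ n =>
    P (unpair1 (unpair1 n)) (unpair2 (unpair1 n))).
  have eX : eff (fun _ n => unpair1 n) by eff.
  exact: (eff_comp eP eX).
have [s es sP] := code_smn; exists (s (encode (CMu c))) => [|a].
  by apply: eff_ext (eff_comp es (eff_pair (eff_const _) eff_id)) => p n;
     rewrite !unpairE.
have [d sa dP] := sP (CMu c) a.
apply/seteqP; split=> [n /= Pn|n [m]].
  exists 0, d => //; apply/dP; split=> //.
  by have := cP (fun=> 0) <|<|a, n|>, 0|>; rewrite !unpairE Pn.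
rewrite -sa => /Phi_encode /dP[+ _].
move=> /= cm; apply: contraT => /negbTE nP.
have := cP (fun=> 0) <|<|a, n|>, m|>; rewrite !unpairE nP => cm'.
have E x : eval (fun=> 0) c <|<|a, n|>, m|> x -> phi (encode c) <|<|a, n|>, m|> x.
  by exists c.
by have := phi_functional (E _ cm) (E _ cm').
Qed.

Fixpoint subst_oracle (d c : Defs.code) : Defs.code :=
  match c with
  | COracle => d
  | CPair f g => CPair (subst_oracle d f) (subst_oracle d g)
  | CComp f g => CComp (subst_oracle d f) (subst_oracle d g)
  | CPrec f g => CPrec (subst_oracle d f) (subst_oracle d g)
  | CMu f => CMu (subst_oracle d f)
  | c => c
  end.

Lemma eval_subst_oracle p p' d c n m : (forall n, eval p' d n (p n)) ->
  eval p c n m -> eval p' (subst_oracle d c) n m.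
Proof.
move=> dP; elim: c n m => //=.
- by move=> n _ ->.
- move=> f IHf g IHg n m [a [b [fa gb ->]]].
  by exists a, b; split; [exact: IHf|exact: IHg|].
- by move=> f IHf g IHg n m [r /IHg gr /IHf fm]; exists r.
- move=> f IHf g IHg n; move: (unpair1 n) (unpair2 n) => a k.
  elim: k => [|k IH] m /=; first exact: IHf.
  by move=> [r /IH fr /IHg gm]; exists r.
- move=> f IHf n m [/IHf f0 fS]; split=> // i /fS[v /IHf fv].
  by exists v.
Qed.

(** [c] is fixed, so the recursion over its structure takes place outside the computation and [s] is
    a fixed arithmetic expression in the index of [d]. *)
Lemma encode_subst_oracle c : exists2 s : nat -> nat, eff (fun _ i => s i) &
  forall d, encode (subst_oracle d c) = s (encode d).
Proof.
elim: c => /=.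
- by exists (fun=> 0) => //; eff.
- by exists (fun=> 1) => //; eff.
- by exists (fun=> 2) => //; eff.
- by exists (fun=> 3) => //; eff.
- by exists id => //; eff.
- move=> f [s es sP] g [t et tP]; exists (fun i => 5 + 4 * <|s i, t i|>).
    by eff.
  by move=> d; rewrite sP tP.
- move=> f [s es sP] g [t et tP]; exists (fun i => 6 + 4 * <|s i, t i|>).
    by eff.
  by move=> d; rewrite sP tP.
- move=> f [s es sP] g [t et tP]; exists (fun i => 7 + 4 * <|s i, t i|>).
    by eff.
  by move=> d; rewrite sP tP.
- move=> f [s es sP]; exists (fun i => 8 + 4 * s i); first by eff.
  by move=> d; rewrite sP.
Qed.

(** * Rational-valued computable functionals *)

Local Open Scope ring_scope.

Definition effq (F : (nat -> nat) -> nat -> rat) : Prop :=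
  exists2 G, eff G & forall p n, F p n = ratn (G p n).

Lemma ratn_pair a b d : ratn <|<|a, b|>, d|> = (a%:R - b%:R) / d.+1%:R.
Proof. by rewrite /ratn !unpairE. Qed.

Lemma posratn_pair a d : posratn <|a, d|> = a.+1%:R / d.+1%:R.
Proof. by rewrite /posratn !unpairE. Qed.

Lemma effq_ext F G : (forall p n, F p n = G p n) -> effq G -> effq F.
Proof. by move=> FG [c ec cP]; exists c => // p n; rewrite FG. Qed.

Lemma effq_comp F G : effq F -> eff G -> effq (fun p n => F p (G p n)).
Proof.
by move=> [f ef fP] eG; exists (fun p n => f p (G p n)) => //; eff.
Qed.

Lemma effq_ratn X : eff X -> effq (fun p n => ratn (X p n)).
Proof. by exists X. Qed.

Lemma effq_nat X : eff X -> effq (fun p n => (X p n)%:R).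
Proof.
move=> eX; exists (fun p n => <|<|X p n, 0|>, 0|>); first by eff.
by move=> p n; rewrite ratn_pair subr0 divr1.
Qed.

Lemma effq_opp F : effq F -> effq (fun p n => - F p n).
Proof.
move=> [f ef fP]; exists (fun p n =>
  <|<|unpair2 (unpair1 (f p n)), unpair1 (unpair1 (f p n))|>,
    unpair2 (f p n)|>); first by eff.
by move=> p n; rewrite fP ratn_pair /ratn -mulNr opprB.
Qed.

Lemma effq_add F G : effq F -> effq G -> effq (fun p n => F p n + G p n).
Proof.
(* A code stores the numerator as a difference and the denominator minus 1, hence the crossed
   products and the final predecessor. *)
move=> [f ef fP] [g eg gP]; exists (fun p n =>
  <|<|unpair1 (unpair1 (f p n)) * (unpair2 (g p n)).+1 +
      unpair1 (unpair1 (g p n)) * (unpair2 (f p n)).+1,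
      unpair2 (unpair1 (f p n)) * (unpair2 (g p n)).+1 +
      unpair2 (unpair1 (g p n)) * (unpair2 (f p n)).+1|>,
    ((unpair2 (f p n)).+1 * (unpair2 (g p n)).+1).-1|>)%N; first by eff.
move=> p n; rewrite fP gP ratn_pair /ratn prednK ?muln_gt0 //.
rewrite !natrD !natrM.
have := @pnatr_eq0 rat (unpair2 (f p n)).+1.
have := @pnatr_eq0 rat (unpair2 (g p n)).+1.
move: (_.+1%:R) (_.+1%:R) => x y /negbT y0 /negbT x0.
by field; rewrite x0 y0.
Qed.

Lemma effq_mul F G : effq F -> effq G -> effq (fun p n => F p n * G p n).
Proof.
move=> [f ef fP] [g eg gP]; exists (fun p n =>
  <|<|unpair1 (unpair1 (f p n)) * unpair1 (unpair1 (g p n)) +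
      unpair2 (unpair1 (f p n)) * unpair2 (unpair1 (g p n)),
      unpair1 (unpair1 (f p n)) * unpair2 (unpair1 (g p n)) +
      unpair2 (unpair1 (f p n)) * unpair1 (unpair1 (g p n))|>,
    ((unpair2 (f p n)).+1 * (unpair2 (g p n)).+1).-1|>)%N; first by eff.
move=> p n; rewrite fP gP ratn_pair /ratn prednK ?muln_gt0 //.
rewrite !natrD !natrM.
have := @pnatr_eq0 rat (unpair2 (f p n)).+1.
have := @pnatr_eq0 rat (unpair2 (g p n)).+1.
move: (_.+1%:R) (_.+1%:R) => x y /negbT y0 /negbT x0.
by field; rewrite x0 y0.
Qed.

Lemma effq_invS X : eff X -> effq (fun p n => (X p n).+1%:R^-1).
Proof.
move=> eX; exists (fun p n => <|<|1, 0|>, X p n|>%N); first by eff.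
by move=> p n; rewrite ratn_pair subr0 mul1r.
Qed.

Lemma effq_exp2V X : eff X -> effq (fun p n => 2 ^- X p n).
Proof.
move=> eX; apply: (@effq_ext _ (fun p n => (2 ^ X p n).-1.+1%:R^-1)).
  by move=> p n; rewrite prednK ?expn_gt0 // natrX.
by apply: effq_invS; eff.
Qed.

Lemma effq_posratn X : eff X -> effq (fun p n => posratn (X p n)).
Proof.
move=> eX; apply: effq_mul; last by apply: effq_invS; eff.
by apply: effq_nat; eff.
Qed.

Lemma effq_if (b : (nat -> nat) -> nat -> bool) F G :
  eff b -> effq F -> effq G -> effq (fun p n => if b p n then F p n else G p n).
Proof.
move=> eb [f ef fP] [g eg gP].
exists (fun p n => if b p n then f p n else g p n); first by eff.
by move=> p n; case: (b p n).
Qed.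

Lemma eff_ltq F G : effq F -> effq G -> eff (fun p n => F p n < G p n).
Proof.
(* Denominators are cleared and negative parts moved to the other side, which leaves a comparison of
   natural numbers. *)
move=> [f ef fP] [g eg gP]; apply: (@eff_ext _ (fun p n =>
  (unpair1 (unpair1 (f p n)) * (unpair2 (g p n)).+1 +
   unpair2 (unpair1 (g p n)) * (unpair2 (f p n)).+1).+1 <=
  (unpair1 (unpair1 (g p n)) * (unpair2 (f p n)).+1 +
   unpair2 (unpair1 (f p n)) * (unpair2 (g p n)).+1))%N); last by eff.
move=> p n; congr nat_of_bool; rewrite fP gP /ratn.
move: (unpair1 (unpair1 (f p n))) (unpair2 (unpair1 (f p n))) => a b.
move: (unpair1 (unpair1 (g p n))) (unpair2 (unpair1 (g p n))) => a' b'.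
move: (unpair2 (f p n)) (unpair2 (g p n)) => d d'.
rewrite ltr_pdivlMr ?ltr0n // mulrAC ltr_pdivrMr ?ltr0n //.
rewrite -(ltr_nat rat) !natrD !natrM !mulrBl.
by apply/idP/idP; lra.
Qed.

Lemma eff_leq_rat F G : effq F -> effq G -> eff (fun p n => F p n <= G p n).
Proof.
move=> eF eG; apply: (@eff_ext _ (fun p n => ~~ (G p n < F p n))).
  by move=> p n; rewrite leNgt.
by apply: eff_negb; exact: eff_ltq.
Qed.

Lemma effq_norm F : effq F -> effq (fun p n => `|F p n|).
Proof.
move=> eF; apply: (@effq_ext _ (fun p n => if 0 <= F p n then F p n else - F p n)).
  by move=> p n; case: ger0P.
apply: effq_if => //; last exact: effq_opp.
by apply: eff_leq_rat => //; apply: (@effq_nat (fun _ _ => 0)); eff.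
Qed.

Lemma effq_max0 F : effq F -> effq (fun p n => Num.max 0 (F p n)).
Proof.
move=> eF; apply: (@effq_ext _ (fun p n => if 0 <= F p n then F p n else 0%:R)).
  by move=> p n; case: (lerP 0 (F p n)).
apply: effq_if => //; last by apply: (@effq_nat (fun _ _ => 0)); eff.
by apply: eff_leq_rat => //; apply: (@effq_nat (fun _ _ => 0)); eff.
Qed.

Lemma effq_sum N (F : (nat -> nat) -> nat -> nat -> rat) :
    eff N -> effq (fun p n => F p (unpair1 n) (unpair2 n)) ->
  effq (fun p n => \sum_(0 <= j < N p n) F p n j).
Proof.
move=> eN eF.
have [h eh hP] : effq (fun p n => F p (unpair1 n) (unpair1 (unpair2 n)) +
                         ratn (unpair2 (unpair2 n))).
  apply: effq_add; last by apply: effq_ratn; eff.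
  apply: (@effq_ext _ (fun p n => (fun p n => F p (unpair1 n) (unpair2 n)) p
       <|unpair1 n, unpair1 (unpair2 n)|>)) => [p n|].
    by rewrite !unpairE.
  by apply: (effq_comp eF); eff.
exists (fun p n =>
    iteri (N p n) (fun j r => h p <|n, <|j, r|> |>) <|<|0, 0|>, 0|>%N).
  by eff.
move=> p n; elim: (N p n) => [|m IH] /=.
  by rewrite big_geq // ratn_pair subrr mul0r.
rewrite big_nat_recr //= IH addrC.
by have := hP p <|n, <|m, iteri m (fun j r => h p <|n, <|j, r|> |>)
                                <|<|0, 0|>, 0|>%N|> |>; rewrite !unpairE.
Qed.

Lemma ratn_surj q : exists n, ratn n = q.
Proof.
have [d dP] : exists d, denq q = d.+1%:Z.
  by have := denq_gt0 q; case: (denq q) => [[|d]|d] // _; exists d.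
have qE : q = (numq q)%:~R / d.+1%:R by rewrite -[LHS]divq_num_den dP.
case: (numq q) qE => [a ->|a ->].
  by exists <|<|a, 0|>, d|>%N; rewrite ratn_pair subr0.
by exists <|<|0, a.+1|>, d|>%N; rewrite ratn_pair sub0r NegzE mulrNz.
Qed.

Lemma posratn_surj q : 0 < q -> exists n, posratn n = q.
Proof.
move=> q0; have [n nE] := ratn_surj q.
exists <|(unpair1 (unpair1 n) - unpair2 (unpair1 n)).-1, unpair2 n|>%N.
have lt : (unpair2 (unpair1 n) < unpair1 (unpair1 n))%N.
  move: q0; rewrite -nE /ratn pmulr_lgt0 ?invr_gt0 ?ltr0n //.
  by rewrite subr_gt0 ltr_nat.
by rewrite /posratn !unpairE prednK ?subn_gt0 // natrB ?(ltnW lt) // -nE.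
Qed.

Lemma posratn_gt0 n : 0 < posratn n.
Proof. by rewrite /posratn divr_gt0 // ltr0n. Qed.

Lemma effq_const q : effq (fun _ _ => q).
Proof. by have [n <-] := ratn_surj q; apply: effq_ratn; eff. Qed.

Ltac effq_step :=
  lazymatch goal with
  | H : effq ?F |- effq ?F => exact H
  | |- effq (fun _ _ => ?k) => exact: (effq_const k)
  | |- effq (fun p n => ratn _) => apply: effq_ratn
  | |- effq (fun p n => posratn _) => apply: effq_posratn
  | |- effq (fun p n => (2 ^+ _)^-1) => apply: effq_exp2V
  | |- effq (fun p n => (_.+1%:R)^-1) => apply: effq_invS
  | |- effq (fun p n => _%:R) => apply: effq_nat
  | |- effq (fun p n => - _) => apply: effq_opp
  | |- effq (fun p n => _ + _) => apply: effq_add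
  | |- effq (fun p n => _ * _) => apply: effq_mul
  | |- effq (fun p n => `| _ |) => apply: effq_norm
  | |- effq (fun p n => Num.max 0 _) => apply: effq_max0
  | |- effq (fun p n => \sum_(0 <= j < _) _) => apply: effq_sum
  | H : effq ?F |- effq (fun p n => ?F p (@?G p n)) =>
      apply: (effq_comp (F := F) H)
  | |- eff (fun p n => nat_of_bool (_ < _)) => apply: eff_ltq
  | |- eff (fun p n => nat_of_bool (_ <= _)) => apply: eff_leq_rat
  | |- eff (fun p n => run _ _ _ _) => apply: eff_run
  | _ => eff_machine
  end.
Ltac eff_ext ::= effq_step.
Ltac effq := repeat (first [effq_step | eff_step]).

Lemma effq_itv_lo X : eff X -> effq (fun p n => itv_lo (X p n)).
Proof. by rewrite /itv_lo => eX; effq. Qed.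

Lemma effq_itv_hi X : eff X -> effq (fun p n => itv_hi (X p n)).
Proof. by rewrite /itv_hi /itv_lo => eX; effq. Qed.

Opaque ratn posratn.

(** * Computable functions and their compact-open names *)

Lemma exp2V_gt0 (F : numFieldType) n : 0 < 2 ^- n :> F.
Proof. by rewrite invr_gt0 exprn_gt0. Qed.

Lemma exp2V_S (F : numFieldType) n : 2 ^- n.+1 = 2 ^- n / 2 :> F.
Proof. by rewrite exprS invfM mulrC. Qed.

Lemma exp2V_lt (R : archiRealFieldType) (e : R) : 0 < e -> exists n, 2 ^- n < e.
Proof.
move=> e0; exists (Num.truncn e^-1).+1.
have lt := truncnS_gt e^-1.
rewrite invf_plt ?posrE ?exprn_gt0 //; apply: (lt_trans lt).
by rewrite -natrX ltr_nat ltn_expl.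
Qed.

Lemma exp2V_le (F : numFieldType) m n : (m <= n)%N -> 2 ^- n <= 2 ^- m :> F.
Proof. by move=> mn; rewrite lef_pV2 ?posrE ?exprn_gt0 // ler_weXn2l ?ler1n. Qed.

Lemma ratr_exp2V (R : realType) n : ratr (2 ^- n) = 2 ^- n :> R.
Proof. by rewrite fmorphV rmorphXn /= ratr_nat. Qed.

Lemma ratrD (R : numFieldType) a b : ratr (a + b) = ratr a + ratr b :> R.
Proof. exact: rmorphD. Qed.

Lemma ratrB (R : numFieldType) a b : ratr (a - b) = ratr a - ratr b :> R.
Proof. exact: rmorphB. Qed.

Lemma ratrM (R : numFieldType) a b : ratr (a * b) = ratr a * ratr b :> R.
Proof. exact: rmorphM. Qed.

Lemma ratn_dense (R : realType) (x e : R) : 0 < e ->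
  exists n, `|x - ratr (ratn n)| < e.
Proof.
move=> e0; have [|q] := @rat_in_itvoo R (x - e) (x + e); first by lra.
rewrite in_itv /= => /andP[q1 q2]; have [n nq] := ratn_surj q.
by exists n; rewrite nq ltr_norml; apply/andP; split; lra.
Qed.

Lemma ratr_norm_lt (R : realType) (a b e : rat) :
  (`|ratr a - ratr b| < ratr e :> R) = (`|a - b| < e).
Proof. by rewrite -rmorphB -(ltr_rat R) ratr_norm. Qed.

(** * Finite pieces of Cauchy names *)

Definition list_name (u l : nat) : bool :=
  all (fun k => `|ratn (nthc l k) - ratn (nthc l k.+1)| < 2 ^- k) (iota 0 u).

(** The entries are numbered 0 to u, hence the length [u.+1]; the outer successor avoids 0, which
    [orc] reads as the zero oracle. *)
Definition list_oracle (u l : nat) : nat := <|u.+1, l|>.+1.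

Lemma orc_list u l n :
  orc (list_oracle u l) n = if (n <= u)%N then (nthc l n).+1 else 0%N.
Proof. by rewrite /orc /list_oracle /= !unpairE. Qed.

Lemma list_name_extend (R : realType) (x : R) u l :
    list_name u l -> `|x - ratr (ratn (nthc l u))| < 2 ^- u ->
  exists2 p, cauchy_name x p & extends (list_oracle u l) p.
Proof.
move=> /allP lP xu; set q := ratr (ratn (nthc l u)) in xu.
pose e : R := 2 ^- u - `|x - q|.
have e0 : 0 < e by rewrite subr_gt0.
(* The bound [e] takes care of the gap between entries [u] and [u.+1]; the bound 2^-(k+2) takes care
   of the later gaps, by the triangle inequality through [x]. *)
have /choice [r rP] : forall k, exists n,
    `|x - ratr (ratn n)| < Num.min e (2 ^- k.+2).
  by move=> k; apply: ratn_dense; rewrite lt_min e0 exp2V_gt0.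
have r1 k : `|x - ratr (ratn (r k))| < e.
  by have := rP k; rewrite lt_min => /andP[].
have r2 k : `|x - ratr (ratn (r k))| < 2 ^- k.+2.
  by have := rP k; rewrite lt_min => /andP[].
pose p k := if (k <= u)%N then nthc l k else r k.
exists p; last first.
  by move=> n; rewrite orc_list /p; case: ifP => _; [right|left].
split.
  apply/cvgrPdist_lt => d d0; have [N Nd] := exp2V_lt d0.
  near=> k; rewrite /p leqNgt ifF; last by apply/negbF; near: k; exists u.+1.
  apply: (lt_trans (r2 k)); apply: le_lt_trans Nd; apply: exp2V_le.
  by rewrite 2?leqW //; near: k; exists N.
move=> n; rewrite -(ltr_rat R) ratr_norm rmorphB ratr_exp2V /p.
case: (ltngtP n u) => [nu|un|->].
- rewrite -rmorphB -ratr_norm -ratr_exp2V ltr_rat.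
  by apply: lP; rewrite mem_iota.
- apply: le_lt_trans (ler_distD x _ _) _.
  rewrite distrC; have := r2 n; have := r2 n.+1; rewrite !exp2V_S.
  by have := exp2V_gt0 R n; lra.
apply: le_lt_trans (ler_distD x _ _) _.
by rewrite distrC -/q; have := r1 u.+1; rewrite /e; lra.
Unshelve. all: by end_near. Qed.

(** A general Cauchy name is only within 2 * 2^-n of [x]. Names with the sharper bound have all
    their initial segments in the form required by [list_name_extend]. *)
Lemma fast_name (R : realType) (x : R) :
  exists2 p, cauchy_name x p & forall n, `|x - ratr (ratn (p n))| < 2 ^- n.
Proof.
have /choice [r r2] : forall k, exists n, `|x - ratr (ratn n)| < 2 ^- k.+2.
  by move=> k; apply: ratn_dense; rewrite exp2V_gt0.
exists r => [|n]; last first.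
  by apply: lt_le_trans (r2 n) _; apply: exp2V_le; rewrite 2?leqW.
split.
  apply/cvgrPdist_lt => d d0; have [N Nd] := exp2V_lt d0.
  near=> k; apply: (lt_trans (r2 k)); apply: le_lt_trans Nd; apply: exp2V_le.
  by rewrite 2?leqW //; near: k; exists N.
move=> n; rewrite -(ltr_rat R) ratr_norm rmorphB ratr_exp2V.
apply: le_lt_trans (ler_distD x _ _) _.
rewrite distrC; have := r2 n; have := r2 n.+1; rewrite !exp2V_S.
by have := exp2V_gt0 R n; lra.
Unshelve. all: by end_near. Qed.

Lemma cauchy_name_dist (R : realType) (x : R) p n :
  cauchy_name x p -> `|x - ratr (ratn (p n))| <= 2 * 2 ^- n.
Proof.
move=> [px pS]; pose q k : R := ratr (ratn (p k)).
have step k : `|q k - q k.+1| < 2 ^- k.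
  by rewrite -ratr_exp2V ratr_norm_lt.
(* Partial sum of the geometric series; the subtracted term is what makes the induction go
   through. *)
have dist d : `|q n - q (n + d)%N| <= 2 * 2 ^- n - 2 * 2 ^- (n + d)%N.
  elim: d => [|d IH]; first by rewrite addn0 !subrr normr0.
  apply: le_trans (ler_distD (q (n + d)%N) _ _) _.
  have := step (n + d)%N; rewrite addnS exp2V_S; move: IH; lra.
apply/ler_addgt0Pr => e e0.
move/cvgrPdist_lt: px => /(_ e e0) [N _ NP].
have := NP (n + N)%N (leq_addl _ _); rewrite /= -/(q _) => qe.
apply: le_trans (ler_distD (q (n + N)%N) _ _) _.
rewrite -/(q n); have := dist N; rewrite (distrC (q n)).
by have := exp2V_gt0 R (n + N); lra.
Qed.

(** The list extends to a name of every such [y], while the run sees only the list. One halting run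
    thus controls [f] on a whole interval. *)
Lemma realfun_run_sound (R : realType) (f : R -> R) i (y : R) u l s n v :
    realfun_index f i -> list_name u l ->
    `|y - ratr (ratn (nthc l u))| < 2 ^- u ->
    run (list_oracle u l) s i n = v.+1 ->
  `|f y - ratr (ratn v)| <= 2 * 2 ^- n.
Proof.
move=> fi ul yu sv; have [p py zp] := list_name_extend ul yu.
have [q qfy qP] := fi _ _ py.
by rewrite (run_extends zp sv (qP n)); exact: cauchy_name_dist.
Qed.

Lemma realfun_run_complete (R : realType) (f : R -> R) i (x : R) n :
    realfun_index f i -> exists u l s v,
  [/\ list_name u l, `|x - ratr (ratn (nthc l u))| < 2 ^- u &
      run (list_oracle u l) s i n = v.+1].
Proof.
move=> fi; have [p px p_fast] := fast_name x.
have [q qfx qP] := fi _ _ px.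
have [u [s us]] := run_use (qP n).
have [l lp] := nthc_surj p u.+1.
exists u, l, s, (q n); split.
- apply/allP => k; rewrite mem_iota /= add0n => ku.
  by rewrite !lp ?ltnS ?(ltnW ku) //; apply: px.2.
- by rewrite lp.
by apply: us => k ku; rewrite orc_list (ltnW ku) lp // ltnS ltnW.
Qed.

Lemma realfun_continuous (R : realType) (f : R -> R) i :
  realfun_index f i -> continuous f.
Proof.
move=> fi x; apply/cvgrPdist_lt => e e0.
have e4 : 0 < e / 4 by rewrite divr_gt0.
have [n ne] := exp2V_lt e4.
have [u [l [s [v [ul xu sv]]]]] := realfun_run_complete x n fi.
have [d0 dE] : exists d, 0 < d /\ d = 2 ^- u - `|x - ratr (ratn (nthc l u))|.
  by exists (2 ^- u - `|x - ratr (ratn (nthc l u))|); rewrite subr_gt0.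
near=> y.
have yu : `|y - ratr (ratn (nthc l u))| < 2 ^- u.
  have : `|x - y| < d0 by near: y; apply/nbhs_ballP; exists d0; [case: dE|].
  by have := ler_distD x y (ratr (ratn (nthc l u))); rewrite (distrC y x) dE.2; lra.
have := realfun_run_sound fi ul xu sv; have := realfun_run_sound fi ul yu sv.
have := ler_distD (ratr (ratn v)) (f x) (f y).
by rewrite (distrC (ratr _) (f y)); lra.
Unshelve. all: by end_near. Qed.

(** The margin 2 * 2^-n is the error in [realfun_run_sound]; the strict inequalities on [a] and [b]
    put the closed cell inside the interval controlled by the list. *)
Definition cell_ok (i J : nat) (a b : rat) (u l s n : nat) : bool :=
  [&& list_name u l,
      ratn (nthc l u) - 2 ^- u < a,
      b < ratn (nthc l u) + 2 ^- u,
      (0 < run (list_oracle u l) s i n)%N,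
      itv_lo J < ratn (run (list_oracle u l) s i n).-1 - 2 * 2 ^- n &
      ratn (run (list_oracle u l) s i n).-1 + 2 * 2 ^- n < itv_hi J].

Definition mesh (I M j : nat) : rat :=
  itv_lo I + posratn (unpair2 I) * j%:R * M.+1%:R^-1.

Definition range_ok (i c w : nat) : bool :=
  all (fun j => cell_ok i (unpair2 c)
         (mesh (unpair1 c) (unpair1 w) j) (mesh (unpair1 c) (unpair1 w) j.+1)
         (unpair1 (unpair1 (nthc (unpair2 w) j)))
         (unpair2 (unpair1 (nthc (unpair2 w) j)))
         (unpair1 (unpair2 (nthc (unpair2 w) j)))
         (unpair2 (unpair2 (nthc (unpair2 w) j))))
      (iota 0 (unpair1 w).+1).

Lemma eff_list_name U L : eff U -> eff L ->
  eff (fun p n => list_name (U p n) (L p n)).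
Proof. by rewrite /list_name => eU eL; effq. Qed.

Lemma eff_cell_ok I J A B U L S N : eff I -> eff J -> effq A -> effq B ->
    eff U -> eff L -> eff S -> eff N ->
  eff (fun p n => cell_ok (I p n) (J p n) (A p n) (B p n)
                          (U p n) (L p n) (S p n) (N p n)).
Proof.
rewrite /cell_ok /list_oracle => eI eJ eA eB eU eL eS eN.
have eJl := effq_itv_lo eJ; have eJh := effq_itv_hi eJ.
have eV := eff_list_name eU eL.
by effq.
Qed.

Lemma effq_mesh I M J : eff I -> eff M -> eff J ->
  effq (fun p n => mesh (I p n) (M p n) (J p n)).
Proof. by rewrite /mesh /itv_lo => eI eM eJ; effq. Qed.

Lemma eff_range_ok I C W : eff I -> eff C -> eff W ->
  eff (fun p n => range_ok (I p n) (C p n) (W p n)).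
Proof.
rewrite /range_ok => eI eC eW; apply: eff_all; first by eff.
by apply: eff_cell_ok; try apply: effq_mesh; eff.
Qed.

Lemma ratr_mesh (R : realType) I M j : ratr (mesh I M j) =
  ratr (itv_lo I) + ratr (posratn (unpair2 I)) * j%:R / M.+1%:R :> R.
Proof.
rewrite /mesh; move: (itv_lo I) (posratn _) => a b.
by rewrite rmorphD !rmorphM fmorphV /= !ratr_nat.
Qed.

Lemma mesh0 I M : mesh I M 0 = itv_lo I.
Proof. by rewrite /mesh mulr0 mul0r addr0. Qed.

Lemma mesh_last I M : mesh I M M.+1 = itv_hi I.
Proof. by rewrite /mesh mulfK ?pnatr_eq0. Qed.

Lemma mesh_cell (R : realType) I M (y : R) : @compact_itv R I y ->
  exists2 j, (j <= M)%N & ratr (mesh I M j) <= y <= ratr (mesh I M j.+1).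
Proof.
rewrite /compact_itv /= in_itv /= => /andP[ly yh].
have ex : exists j, y <= ratr (mesh I M j.+1) by exists M; rewrite mesh_last.
have [j jP j_min] := ex_minnP ex; exists j.
  by apply: j_min; rewrite mesh_last.
rewrite jP andbT; case: j jP j_min => [_ _|j _ j_min]; first by rewrite mesh0.
by rewrite leNgt; apply/negP => /ltW /j_min; rewrite ltnn.
Qed.

Lemma range_ok_sound (R : realType) (f : R -> R) i c w :
  realfun_index f i -> range_ok i c w -> conbhd c f.
Proof.
move=> fi /allP ok; split; first exact: realfun_continuous fi.
move=> _ [y /(@mesh_cell _ _ (unpair1 w)) [j jM /andP[jy yj]] <-].
have := ok j; rewrite mem_iota /= add0n ltnS jM => /(_ isT).
rewrite /cell_ok; set u := unpair1 _; set l := unpair2 (unpair1 _).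
set s := unpair1 (unpair2 _); set n := unpair2 (unpair2 (nthc _ _)).
move=> /and5P[ul qa bq rn /andP[vl vh]].
have yu : `|y - ratr (ratn (nthc l u))| < 2 ^- u.
  move: qa bq; rewrite -!(ltr_rat R) (ratrB _ (ratn _)) (ratrD _ (ratn _)).
  by rewrite ratr_exp2V ltr_norml => qa bq; apply/andP; split; lra.
have := realfun_run_sound fi ul yu (esym (prednK rn)).
rewrite ler_norml => /andP[f1 f2].
move: vl vh; rewrite -!(ltr_rat R) (ratrB _ (ratn _)) (ratrD _ (ratn _)) !(ratrM _ 2) ratr_nat ratr_exp2V.
by move=> vl vh; rewrite /open_itv /= in_itv /=; apply/andP; split; lra.
Qed.

Lemma ball_cell (R : realFieldType) (x x' q u h : R) :
    `|x - q| < u -> `|x - x'| < (u - `|x - q|) / 2 ->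
    `|h| < (u - `|x - q|) / 2 ->
  q - u < x' /\ x' + h < q + u.
Proof.
have : `|x - q| <= `|x - q| by [].
rewrite {1}ler_norml !ltr_norml; move: `|x - q| => D.
by move=> /andP[? ?] ? /andP[? ?] /andP[? ?]; split; lra.
Qed.

Lemma margin (R : realFieldType) (y v a b h e : R) :
    h < e / 4 -> - (2 * h) <= y - v -> y - v <= 2 * h ->
    e <= y - a -> e <= b - y ->
  a < v - 2 * h /\ v + 2 * h < b.
Proof. by move=> *; split; lra. Qed.

(** Compactness in its near-covering form: a witness at [x] still works for cells starting near [x]
    once the mesh is fine, so one [M] serves all cells of the interval. *)
Lemma range_ok_complete (R : realType) (f : R -> R) i c :
  realfun_index f i -> conbhd c f -> exists w, range_ok i c w.
Proof.
move=> fi [_ fIJ]; pose I := unpair1 c; pose J := unpair2 c.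
pose len : R := ratr (posratn (unpair2 I)).
(* [x] is the left end of a cell. It is real while the test takes rationals, hence the
   quantification over rational endpoints with prescribed real values. *)
pose P (M : nat) (x : R) := exists t : nat * nat * (nat * nat),
  forall a b : rat, ratr a = x -> ratr b = x + len / M.+1%:R ->
    cell_ok i J a b t.1.1 t.1.2 t.2.1 t.2.2.
have : \forall M \near \oo, forall x, @compact_itv R I x -> P M x.
  have /compact_near_coveringP := @segment_compact R (ratr (itv_lo I)) (ratr (itv_hi I)).
  apply => x Ix.
  have : @open_itv R J (f x) by apply: fIJ; exists x.
  rewrite /open_itv /= in_itv /= => /andP[Jl Jh].
  pose e := Num.min (f x - ratr (itv_lo J)) (ratr (itv_hi J) - f x).
  have e0 : 0 < e / 4 by rewrite divr_gt0 // lt_min !subr_gt0 Jl.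
  have [n ne] := exp2V_lt e0.
  have [u [l [s [v [ul xu sv]]]]] := realfun_run_complete x n fi.
  have := realfun_run_sound fi ul xu sv; rewrite ler_norml => /andP[v1 v2].
  have [e1 e2] : e <= f x - ratr (itv_lo J) /\ e <= ratr (itv_hi J) - f x.
    by rewrite /e !ge_min !lexx orbT.
  pose d := 2 ^- u - `|x - ratr (ratn (nthc l u))|.
  have d0 : 0 < d by rewrite subr_gt0.
  have d2 : 0 < d / 2 by rewrite divr_gt0.
  have nearx : \forall x' \near x, `|x - x'| < d / 2.
    by apply/nbhs_ballP; exists (d / 2); [exact: d2|].
  have nearM : \forall M \near \oo, `|len / M.+1%:R| < d / 2.
    have : (fun M : nat => len / M.+1%:R) @ \oo --> len * 0.
      by apply: cvgMr; exact: cvg_harmonic.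
    rewrite mulr0 => /cvgr0Pnorm_lt; exact.
  near=> x' M; exists ((u, l), (s, n)) => a b /= ax bx.
  have x'd : `|x - x'| < d / 2 by near: x'.
  have Md : `|len / M.+1%:R| < d / 2 by near: M.
  have [x'l x'h] := ball_cell xu x'd Md.
  rewrite /cell_ok ul sv /= -!(ltr_rat R) !(ratrB _ (ratn _))
    (ratrD _ (ratn (nthc l u))) (ratrD _ (ratn v)) !(ratrM _ 2) ratr_nat !ratr_exp2V ax bx x'l x'h /=.
  have [m1 m2] := margin ne v1 v2 e1 e2.
  by apply/andP.
move=> [M _ /(_ M (leqnn M)) MP].
have /choice [t tP] : forall j : nat, exists t : nat, (j <= M)%N ->
    cell_ok i J (mesh I M j) (mesh I M j.+1) (unpair1 (unpair1 t))
      (unpair2 (unpair1 t)) (unpair1 (unpair2 t)) (unpair2 (unpair2 t)).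
  move=> j; case: (leqP j M) => [jM|_]; last by exists 0%N.
  have [|[[u l] [s n]] /= tP] := MP (ratr (mesh I M j)).
    rewrite /compact_itv /= in_itv /= !ler_rat -{1}(mesh0 I M).
    rewrite -(mesh_last I M) /mesh !lerD2l !ler_pM2r ?invr_gt0 ?ltr0n //.
    by rewrite !ler_pM2l ?posratn_gt0 // !ler_nat leq0n leqW.
  exists <|<|u, l|>, <|s, n|>|>%N => _; rewrite !unpairE; apply: tP => //.
  by rewrite !ratr_mesh -/len -natr1 mulrDr mulr1 mulrDl addrA.
have [w wt] := nthc_surj t M.+1.
exists <|M, w|>%N; apply/allP => j; rewrite mem_iota /= add0n unpairE => jM.
by rewrite unpairE wt //; exact: tP.
Unshelve. all: by end_near. Qed.

(** The target interval is ]-(B + 1), B + 1[, so every continuous function bounded by [B] belongs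
    here. It is the filler output when a test fails, since an enumeration must always answer. *)
Definition bound_conbhd (B : nat) : nat :=
  <|0, <|<|<|0, B.+1|>, 0|>, <|(2 * B).+1, 0|> |> |>%N.

Lemma bound_conbhdP (R : realType) (f : R -> R) B :
  continuous f -> (forall x, `|f x| <= B%:R) -> conbhd (bound_conbhd B) f.
Proof.
move=> fc fB; split=> // _ [x _ <-].
rewrite /open_itv /= /itv_hi /itv_lo /bound_conbhd !unpairE ratn_pair.
rewrite posratn_pair !divr1 sub0r in_itv /=.
rewrite ratrD (rmorphN _ _%:R) /= !ratr_nat -addn2 natrD natrM -natr1.
by have := fB x; rewrite ler_norml => /andP[? ?]; apply/andP; split; lra.
Qed.

Definition enum_conbhd (i B w : nat) : nat :=
  if range_ok i (unpair1 w) (unpair2 w) then unpair1 w else bound_conbhd B.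

Lemma enum_conbhdP (R : realType) (f : R -> R) i B :
    realfun_index f i -> (forall x, `|f x| <= B%:R) ->
  co_name f (enum_conbhd i B).
Proof.
move=> fi fB; apply/seteqP; split=> [_ [w _ <-]|_ [c cf <-]].
  exists (enum_conbhd i B w) => //; rewrite /enum_conbhd /=.
  case: ifP => [|_]; first exact: range_ok_sound.
  by apply: bound_conbhdP => //; exact: realfun_continuous fi.
have [w ok] := range_ok_complete fi cf.
by exists <|c, w|>%N => //; rewrite /enum_conbhd !unpairE ok.
Qed.

Lemma eff_enum_conbhd I B W : eff I -> eff B -> eff W ->
  eff (fun p n => enum_conbhd (I p n) (B p n) (W p n)).
Proof.
rewrite /enum_conbhd /bound_conbhd => eI eB eW.
have eR := eff_range_ok eI (eff_unpair1 eW) (eff_unpair2 eW).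
by eff.
Qed.

(** Three operations on indices are composed: [s] gives an index of the enumeration determined by
    [i] and [B], [t] puts it in place of the oracle in the code of [e], and [u] fixes the argument
    [B]. *)
Lemma effectively_of_uniformly (R : realType) (mu_ : nat -> finmeas R) mu :
  uniformly_effectively_weakly_converges mu_ mu ->
  effectively_weakly_converges mu_ mu.
Proof.
move=> [wc [e eP]]; split.
  move=> f [[i fi] fb]; apply: wc; split=> //; exact: realfun_continuous fi.
have [c ce] := encode_surj e.
have [s es sP] := @eff_smn (fun _ n =>
  enum_conbhd (unpair1 (unpair1 n)) (unpair2 (unpair1 n)) (unpair2 n))
  (eff_enum_conbhd (eff_unpair1 (eff_unpair1 eff_id))
     (eff_unpair2 (eff_unpair1 eff_id)) (eff_unpair2 eff_id)).
have [t et tP] := encode_subst_oracle c.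
have [u eu uP] := code_smn.
have [e' e'P] : exists e', forall p n, Phi e' p n (u (t (s n)) (unpair2 n)).
  apply: eff_phi; apply: (@eff_ext _ (fun p n =>
    (fun _ n => u (unpair1 n) (unpair2 n)) p <|t (s n), unpair2 n|>)).
    by move=> p n; rewrite !unpairE.
  apply: (eff_comp eu); apply: eff_pair; last by eff.
  exact: (eff_comp et es).
exists e' => f i B [_ fb] fi fB; exists (u (t (s <|i, B|>)) B).
  by have := e'P (fun=> 0%N) <|i, B|>; rewrite !unpairE.
have Cbf : Cb f by split=> //; exact: realfun_continuous fi.
have [g gmod gP] := eP _ _ _ Cbf (enum_conbhdP fi fB) fB.
exists g => // k.
have [d ds] := encode_surj (s <|i, B|>).
have [c' c's c'P] := uP (subst_oracle d c) B.
exists c'; first by rewrite c's tP ds.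
apply/c'P; apply: (eval_subst_oracle (p := enum_conbhd i B)); last first.
  by apply: Phi_encode; rewrite ce; exact: gP.
move=> w; apply: Phi_encode; rewrite ds.
by have := sP <|i, B|> (fun=> 0%N) w; rewrite !unpairE.
Qed.

(** * Rational polygons *)

Definition tent (F : realFieldType) (x : F) : F := Num.max 0 (1 - `|x|).

Definition trapezoid (F : realFieldType) (n : nat) (x : F) : F :=
  Num.max 0 (Num.min 1 (Num.min (x + 1) (n.+1%:R - x))).

Lemma tent_ge0 (F : realFieldType) (x : F) : 0 <= tent x.
Proof. by rewrite le_max lexx. Qed.

Lemma trapezoid_ge0 (F : realFieldType) n (x : F) : 0 <= trapezoid n x.
Proof. by rewrite le_max lexx. Qed.

Lemma trapezoid_le1 (F : realFieldType) n (x : F) : trapezoid n x <= 1.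
Proof. by rewrite ge_max ler01 ge_min lexx. Qed.

Lemma trapezoid_eq1 (F : realFieldType) n (x : F) :
  0 <= x <= n%:R -> trapezoid n x = 1.
Proof.
move=> /andP[x0 xn]; rewrite /trapezoid -natr1.
by rewrite min_l ?max_r ?ler01 // le_min; apply/andP; split; lra.
Qed.

Lemma trapezoid_eq0 (F : realFieldType) n (x : F) :
  (x <= -1) || (n.+1%:R <= x) -> trapezoid n x = 0.
Proof.
move=> xn; apply/max_l; rewrite !ge_min.
by case/orP: xn => xn; apply/orP; right; apply/orP; [left|right]; lra.
Qed.

Lemma trapezoid_up (F : realFieldType) n (x : F) :
  -1 <= x <= 0 -> trapezoid n x = x + 1.
Proof.
move=> /andP[x1 x0]; have n0 : 0 <= n%:R :> F by rewrite ler0n.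
by rewrite /trapezoid -natr1 (min_l (_ : x + 1 <= _)) ?min_r ?max_r //; lra.
Qed.

Lemma trapezoid_down (F : realFieldType) n (x : F) :
  n%:R <= x <= n.+1%:R -> trapezoid n x = n.+1%:R - x.
Proof.
rewrite /trapezoid -natr1 => /andP[nx xn].
have n0 : 0 <= n%:R :> F by rewrite ler0n.
by rewrite (min_r (_ : _ <= x + 1)) ?min_r ?max_r //; lra.
Qed.

Lemma tent_eq0 (F : realFieldType) (x : F) : 1 <= `|x| -> tent x = 0.
Proof. by move=> x1; rewrite /tent max_l // subr_le0. Qed.

Lemma tentE (F : realFieldType) (x : F) : `|x| <= 1 -> tent x = 1 - `|x|.
Proof. by move=> x1; rewrite /tent max_r // subr_ge0. Qed.

(** Adding the tent at n + 1 moves the right flank of the trapezoid by one; the cases are the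
    intervals on which all the functions are affine. *)
Lemma sum_tent (F : realFieldType) n (x : F) :
  \sum_(0 <= j < n.+1) tent (x - j%:R) = trapezoid n x.
Proof.
elim: n => [|n IH].
  rewrite big_nat1 subr0; have [x1|x1] := leP 1 `|x|.
    rewrite tent_eq0 // trapezoid_eq0 //; move: x1.
    by rewrite ler_normr => /orP[x1|x1]; apply/orP; [right|left]; lra.
  rewrite tentE ?ltW //; move: x1; rewrite ltr_norml => /andP[x1 x2].
  case: (ger0P x) => x0; first by rewrite trapezoid_down //; lra.
  by rewrite trapezoid_up; lra.
rewrite big_nat_recr //= IH.
have n0 : 0 <= n%:R :> F by rewrite ler0n.
have nS : n.+1%:R = n%:R + 1 :> F by rewrite natr1.
have nSS : n.+2%:R = n%:R + 1 + 1 :> F by rewrite !natr1.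
have [h1|h1] := leP x 0.
  rewrite tent_eq0 ?addr0; last by rewrite ler_normr; apply/orP; right; lra.
  have [h2|h2] := leP x (-1); first by rewrite !trapezoid_eq0 ?h2.
  by rewrite !trapezoid_up // h1 ltW.
have [h2|h2] := leP x n%:R.
  rewrite tent_eq0 ?addr0; last by rewrite ler_normr; apply/orP; right; lra.
  by rewrite !trapezoid_eq1 //; lra.
have [h3|h3] := leP x n.+1%:R.
  rewrite trapezoid_down ?h3 ?(ltW h2) // trapezoid_eq1 ?h3 ?ltW //.
  rewrite tentE ?ler0_norm ?ler_norml; lra.
rewrite (trapezoid_eq0 (n := n)) ?(ltW h3) ?orbT // add0r.
have [h4|h4] := leP x n.+2%:R.
  rewrite trapezoid_down ?h4 ?(ltW h3) // tentE ger0_norm; lra.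
by rewrite tent_eq0 ?trapezoid_eq0 ?(ltW h4) ?orbT // ger0_norm; lra.
Qed.

Lemma tent_lipschitz (F : realFieldType) (x y : F) :
  `|tent x - tent y| <= `|x - y|.
Proof.
have := ler_dist_dist x y; rewrite /tent.
case: (leP 0 (1 - `|x|)) => hx; case: (leP 0 (1 - `|y|)) => hy.
- by rewrite (_ : 1 - `|x| - _ = `|y| - `|x|); [rewrite (distrC `|y|)|ring].
- rewrite subr0 (ger0_norm hx) => /(le_trans _); apply.
  by rewrite ler_normr; apply/orP; right; lra.
- rewrite sub0r normrN (ger0_norm hy) => /(le_trans _); apply.
  by rewrite ler_normr; apply/orP; left; lra.
by rewrite subrr normr0.
Qed.

(** The nodes are (j - L) / (M + 1) for j <= 2 * L. The constant [c] is the value far out, which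
    lets [tail] be a polygon too. *)
Definition polygon (F : realFieldType) (c : F) (M L : nat) (v : nat -> F)
    (x : F) : F :=
  c + \sum_(0 <= j < (2 * L).+1) v j * tent (M.+1%:R * x + L%:R - j%:R).

Lemma polygon_lipschitz (F : realFieldType) (c : F) M L v (x y : F) :
  `|polygon c M L v x - polygon c M L v y| <=
    (\sum_(0 <= j < (2 * L).+1) `|v j|) * M.+1%:R * `|x - y|.
Proof.
rewrite /polygon opprD addrACA subrr add0r -sumrB.
apply: le_trans (ler_norm_sum _ _ _) _.
rewrite -mulrA mulr_suml; apply: ler_sum => j _.
rewrite -mulrBr normrM; apply: ler_wpM2l => //.
apply: le_trans (tent_lipschitz _ _) _.
rewrite (_ : _ - _ = M.+1%:R * (x - y)); last by ring.
by rewrite normrM normr_nat.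
Qed.

Definition polydata (c M L l s : nat) : nat :=
  <|<|c, M|>, <|<|L, l|>, s|> |>%N.

Definition dataC D := unpair1 (unpair1 D).
Definition dataM D := unpair2 (unpair1 D).
Definition dataL D := unpair1 (unpair1 (unpair2 D)).
Definition datal D := unpair2 (unpair1 (unpair2 D)).
Definition datas D := unpair2 (unpair2 D).

Lemma polydataE c M L l s (D := polydata c M L l s) :
  [/\ dataC D = c, dataM D = M, dataL D = L, datal D = l & datas D = s].
Proof.
by rewrite /D /polydata /dataC /dataM /dataL /datal /datas !unpairE.
Qed.

Definition polyQ (D : nat) (x : rat) : rat :=
  polygon (ratn (dataC D)) (dataM D) (dataL D)
    (fun j => ratn (nthc (datal D) j)) x.

Definition polyR (R : realType) (D : nat) (x : R) : R :=
  polygon (ratr (ratn (dataC D))) (dataM D) (dataL D)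
    (fun j => ratr (ratn (nthc (datal D) j))) x.

(** [2 ^ datas D] is a Lipschitz constant. *)
Definition poly_valid (D : nat) : bool :=
  (\sum_(0 <= j < (2 * dataL D).+1) `|ratn (nthc (datal D) j)|)
    * (dataM D).+1%:R <= (2 ^ datas D)%N%:R.

Lemma ratr_tent (R : realType) (x : rat) : ratr (tent x) = tent (ratr x) :> R.
Proof.
have E : ratr (1 - `|x|) = 1 - `|ratr x| :> R.
  by rewrite ratrB ratr_norm rmorph1.
rewrite /tent; case: (leP 0 (1 - `|x|)) => x1.
  by rewrite E max_r // -E ler0q.
by rewrite rmorph0 max_l // -E lerq0 ltW.
Qed.

Lemma ratr_polyQ (R : realType) D q : ratr (polyQ D q) = polyR D (ratr q) :> R.
Proof.
rewrite /polyQ /polyR /polygon ratrD; congr (_ + _); rewrite rmorph_sum /=.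
apply: eq_bigr => j _; rewrite ratrM ratr_tent; congr (_ * tent _).
by rewrite ratrB ratrD ratrM !ratr_nat.
Qed.

Lemma polyQ_lipschitz D x y : poly_valid D ->
  `|polyQ D x - polyQ D y| <= 2 ^+ datas D * `|x - y|.
Proof.
move=> Dv; apply: le_trans (polygon_lipschitz _ _ _ _ _ _) _.
by apply: ler_wpM2r => //; apply: le_trans Dv _; rewrite natrX.
Qed.

Lemma polyR_lipschitz (R : realType) D (x y : R) : poly_valid D ->
  `|polyR D x - polyR D y| <= 2 ^+ datas D * `|x - y|.
Proof.
move=> Dv; apply: le_trans (polygon_lipschitz _ _ _ _ _ _) _.
apply: ler_wpM2r => //.
move: Dv; rewrite /poly_valid -(ler_rat R) ratrM !ratr_nat natrX rmorph_sum /=.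
by under eq_bigr do rewrite ratr_norm.
Qed.

Lemma effq_polyQ D F : eff D -> effq F -> effq (fun p n => polyQ (D p n) (F p n)).
Proof.
rewrite /polyQ /polygon /tent /dataC /dataM /dataL /datal => eD eF.
by effq.
Qed.

Lemma eff_poly_valid D : eff D -> eff (fun p n => poly_valid (D p n)).
Proof.
rewrite /poly_valid /dataM /dataL /datal /datas => eD.
by effq.
Qed.

(** With Lipschitz constant 2^s, reading the name of [x] at n + s makes consecutive outputs differ
    by less than 2^-n. Storing [s] in the data makes this uniform. *)
Lemma poly_index (R : realType) : exists2 idx : nat -> nat,
  eff (fun _ D => idx D) &
  forall D, poly_valid D -> realfun_index (@polyR R D) (idx D).
Proof.
have [G eG GP] : effq (fun p n =>
    polyQ (unpair1 n) (ratn (p (unpair2 n + datas (unpair1 n))%N))).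
  by apply: effq_polyQ; rewrite /datas; effq.
have [idx eidx idxP] := eff_smn eG.
exists idx => // D Dv x p px.
exists (fun n => G p <|D, n|>%N) => [|n]; last exact: idxP.
have E n : ratn (G p <|D, n|>%N) = polyQ D (ratn (p (n + datas D)%N)).
  by rewrite -GP !unpairE.
have s0 (F : numFieldType) : 0 < 2 ^+ datas D :> F by rewrite exprn_gt0.
split=> [|n]; last first.
  rewrite !E; apply: le_lt_trans (polyQ_lipschitz _ _ Dv) _.
  by rewrite addSn -ltr_pdivlMl // -invfM -exprD addnC; exact: px.2.
apply/cvgrPdist_lt => e e0.
have /cvgrPdist_lt /(_ (e / 2 ^+ datas D)) := px.1.
rewrite divr_gt0 // => /(_ isT) [N _ NP]; exists N => // n Nn /=.
rewrite E ratr_polyQ; apply: le_lt_trans (polyR_lipschitz _ _ Dv) _.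
rewrite mulrC -ltr_pdivlMr //; apply: NP.
by rewrite /= (leq_trans Nn) // leq_addr.
Qed.

Lemma polygon_bound (F : realFieldType) M L v (x V : F) :
    (forall j, (j <= 2 * L)%N -> `|v j| <= V) -> 0 <= V ->
  `|polygon 0 M L v x| <= V.
Proof.
move=> vV V0; rewrite /polygon add0r.
apply: le_trans (ler_norm_sum _ _ _) _.
apply: (@le_trans _ _ (V * \sum_(0 <= j < (2 * L).+1)
    tent (M.+1%:R * x + L%:R - j%:R))).
  rewrite mulr_sumr; apply: ler_sum_nat => j /andP[_ jL].
  rewrite normrM (ger0_norm (tent_ge0 _)).
  by apply: ler_wpM2r; [exact: tent_ge0|exact: vV].
by rewrite sum_tent ler_piMr // trapezoid_le1.
Qed.

Definition tail (R : realType) (N : nat) (x : R) : R :=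
  1 - trapezoid (2 * N) (x + N%:R).

Lemma tail_ge0 (R : realType) N (x : R) : 0 <= tail N x.
Proof. by rewrite subr_ge0 trapezoid_le1. Qed.

Lemma tail_le1 (R : realType) N (x : R) : tail N x <= 1.
Proof. by rewrite gerBl trapezoid_ge0. Qed.

Lemma tail_eq0 (R : realType) N (x : R) : - N%:R <= x <= N%:R -> tail N x = 0.
Proof.
move=> /andP[x1 x2]; rewrite /tail trapezoid_eq1 ?subrr // natrM.
by apply/andP; split; lra.
Qed.

Lemma tail_eq1 (R : realType) N (x : R) : N.+1%:R <= `|x| -> tail N x = 1.
Proof.
rewrite ler_normr => xN; rewrite /tail trapezoid_eq0 ?subr0 //.
by rewrite -!natr1 natrM in xN *; case/orP: xN => xN; apply/orP; [right|left]; lra.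
Qed.

(** Off [[-(N + 1), N + 1]] the tail function is [1], and on this interval the
    tents form a partition of unity. *)
Lemma polygon_approx (R : realType) (f : R -> R) (B d : R) N M v (x : R)
    (L := (N.+1 * M.+1)%N) :
    0 <= d -> `|f x| <= B ->
    (forall j, (j <= 2 * L)%N -> `|M.+1%:R * x + L%:R - j%:R| <= 1 ->
       `|f x - v j| <= d) ->
  `|f x - polygon 0 M L v x| <= d + B * tail N x.
Proof.
move=> d0 fB fv; set y := M.+1%:R * x + L%:R.
pose S := trapezoid (2 * L) y.
have -> : f x - polygon 0 M L v x =
    (f x * S - polygon 0 M L v x) + f x * (1 - S) by ring.
apply: le_trans (ler_normD _ _) _; apply: lerD.
  rewrite /S -sum_tent mulr_sumr /polygon add0r -sumrB.
  apply: le_trans (ler_norm_sum _ _ _) _.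
  apply: (@le_trans _ _ (d * \sum_(0 <= j < (2 * L).+1) tent (y - j%:R))).
    rewrite mulr_sumr; apply: ler_sum_nat => j /andP[_ jL].
    rewrite -mulrBl normrM (ger0_norm (tent_ge0 _)).
    have [h|h] := leP `|y - j%:R| 1.
      by apply: ler_wpM2r; [exact: tent_ge0|exact: fv].
    by rewrite /tent max_l ?mulr0 // subr_le0 ltW.
  by rewrite sum_tent ler_piMr // trapezoid_le1.
have S1 : 0 <= 1 - S by rewrite subr_ge0 trapezoid_le1.
rewrite normrM (ger0_norm S1); apply: ler_pM => //.
have [h|h] := leP `|x| N.+1%:R.
  rewrite /S trapezoid_eq1 ?subrr ?tail_ge0 // /y /L !natrM.
  move: h; rewrite ler_norml => /andP[x1 x2].
  have M0 : 0 <= M.+1%:R :> R by rewrite ler0n.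
  by apply/andP; split; nra.
by rewrite (tail_eq1 (ltW h)) gerBl trapezoid_ge0.
Qed.

(** * Integrals of bounded continuous functions *)

Definition mass (R : realType) (mu : finmeas R) : R := fine (mu setT).

Lemma CbP (R : realType) (f : R -> R) :
  Cb f <-> continuous f /\ exists b : R, forall x, `|f x| <= b.
Proof.
split=> [[fc [M [_ Mf]]]|[fc [b fb]]]; split=> //.
  by exists (M + 1) => x; apply: Mf => //; rewrite ltrDl.
exists b; split=> [|M bM x _]; first exact: num_real.
exact: le_trans (fb x) (ltW bM).
Qed.

Lemma Cb_cst (R : realType) (a : R) : Cb (fun=> a : R).
Proof. by apply/CbP; split; [move=> x; exact: cvg_cst|exists `|a|]. Qed.

Lemma CbD (R : realType) (f g : R -> R) :
  Cb f -> Cb g -> Cb (fun x => f x + g x).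
Proof.
move=> /CbP[fc [a fa]] /CbP[gc [b gb]]; apply/CbP; split.
  by move=> x; apply: cvgD; [exact: fc|exact: gc].
exists (a + b) => x; apply: le_trans (ler_normD _ _) _.
by apply: lerD.
Qed.

Lemma CbZ (R : realType) (a : R) (f : R -> R) : Cb f -> Cb (fun x => a * f x).
Proof.
move=> /CbP[fc [b fb]]; apply/CbP; split.
  by move=> x; apply: cvgMr; exact: fc.
by exists (`|a| * b) => x; rewrite normrM ler_wpM2l.
Qed.

Lemma integrable_Cb (R : realType) (mu : finmeas R) (f : R -> R) :
  Cb f -> mu.-integrable setT (EFin \o f).
Proof.
move=> [fc fb].
apply: (@measurable_bounded_integrable _ (measurableTypeR R) R mu f setT).
- exact: measurableT.
- exact/fin_num_fun_lty/fin_num_measure.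
- exact: continuous_measurable_fun.
- exact: fb.
Qed.

Lemma integral_ofD (R : realType) (mu : finmeas R) (f g : R -> R) :
    Cb f -> Cb g ->
  integral_of mu (fun x => f x + g x) = integral_of mu f + integral_of mu g.
Proof. by move=> Cf Cg; apply: RintegralD => //; exact: integrable_Cb. Qed.

Lemma integral_ofZ (R : realType) (mu : finmeas R) (a : R) (f : R -> R) :
  Cb f -> integral_of mu (fun x => a * f x) = a * integral_of mu f.
Proof. by move=> Cf; apply: RintegralZl => //; exact: integrable_Cb. Qed.

Lemma integral_of_cst (R : realType) (mu : finmeas R) (a : R) :
  integral_of mu (fun=> a) = a * mass mu.
Proof. by rewrite /integral_of Rintegral_cst. Qed.

Lemma integral_of_le (R : realType) (mu : finmeas R) (f g : R -> R) :
  Cb f -> Cb g -> (forall x, f x <= g x) -> integral_of mu f <= integral_of mu g.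
Proof.
by move=> Cf Cg fg; apply: le_Rintegral => //; exact: integrable_Cb.
Qed.

Lemma integral_of_dist (R : realType) (mu : finmeas R) (f g h : R -> R) (d b : R) :
    Cb f -> Cb g -> Cb h -> (forall x, `|f x - g x| <= d + b * h x) ->
  `|integral_of mu f - integral_of mu g| <= d * mass mu + b * integral_of mu h.
Proof.
move=> Cf Cg Ch fgh.
have Cdh : Cb (fun x => d + b * h x).
  by apply: CbD; [exact: Cb_cst|exact: CbZ].
have E : integral_of mu (fun x => d + b * h x) =
    d * mass mu + b * integral_of mu h.
  by rewrite integral_ofD ?integral_of_cst ?integral_ofZ //;
    [exact: Cb_cst|exact: CbZ].
have fg x : f x <= g x + (d + b * h x).
  by have := fgh x; rewrite ler_norml => /andP[_]; rewrite lerBlDl.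
have gf x : g x <= f x + (d + b * h x).
  by have := fgh x; rewrite distrC ler_norml => /andP[_]; rewrite lerBlDl.
have := integral_of_le mu Cf (CbD Cg Cdh) fg.
have := integral_of_le mu Cg (CbD Cf Cdh) gf.
rewrite (integral_ofD mu Cg Cdh) (integral_ofD mu Cf Cdh) E => h1 h2.
by rewrite ler_norml; apply/andP; split; lra.
Qed.

Lemma integral_of_le_indic (R : realType) (mu : finmeas R) (f : R -> R)
    (A : set R) : measurable (A : set (measurableTypeR R)) ->
  Cb f -> (forall x, f x <= \1_A x) -> integral_of mu f <= fine (mu A).
Proof.
move=> mA Cf fA.
have <- : integral_of mu \1_A = fine (mu A).
  by rewrite /integral_of /Rintegral integral_indic // setIT.
apply: le_Rintegral => //; first exact: integrable_Cb.
exact: integrable_indic.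
Qed.

Lemma integral_of_ge_indic (R : realType) (mu : finmeas R) (f : R -> R)
    (A : set R) : measurable (A : set (measurableTypeR R)) ->
  Cb f -> (forall x, \1_A x <= f x) -> fine (mu A) <= integral_of mu f.
Proof.
move=> mA Cf fA.
have <- : integral_of mu \1_A = fine (mu A).
  by rewrite /integral_of /Rintegral integral_indic // setIT.
apply: le_Rintegral => //; last exact: integrable_Cb.
exact: integrable_indic.
Qed.

Definition centered (R : realType) (N : nat) : set R := `]- N%:R, N%:R[%classic.

Lemma mass_centered (R : realType) (mu : finmeas R) N :
  fine (mu (~` @centered R N)) = mass mu - fine (mu (@centered R N)).
Proof.
have mN : measurable (@centered R N : set (measurableTypeR R)).
  exact: measurable_itv.
have fin A : measurable (A : set (measurableTypeR R)) -> mu A \is a fin_num.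
  exact: fin_num_measure.
rewrite -fineB ?fin // -setTD measureD ?setTI // ?ltey_eq ?fin //.
Qed.

Lemma centered_cvg (R : realType) (mu : finmeas R) (e : R) : 0 < e ->
  exists N, mass mu - fine (mu (@centered R N)) < e.
Proof.
move=> e0.
have U : \bigcup_N @centered R N = setT.
  apply/seteqP; split=> // x _; exists (Num.truncn `|x|).+1 => //.
  by rewrite /centered /= in_itv /= -ltr_norml truncnS_gt.
have fin A : measurable (A : set (measurableTypeR R)) -> mu A \is a fin_num.
  exact: fin_num_measure.
have mN N : measurable (@centered R N : set (measurableTypeR R)).
  exact: measurable_itv.
have /fine_cvgP[_] : mu (@centered R N) @[N --> \oo] --> (mass mu)%:E.
  rewrite /mass fineK ?fin // -U; apply: nondecreasing_cvg_mu => //.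
    by rewrite U.
  move=> m n mn; apply/subsetPset => x; rewrite /centered /= !in_itv /= => /andP[x1 x2].
  have : m%:R <= n%:R :> R by rewrite ler_nat.
  by move=> ?; apply/andP; split; lra.
move/cvgrPdist_lt => /(_ e e0) [N _ /(_ N (leqnn N)) /=].
by rewrite ltr_norml => /andP[_ ?]; exists N.
Qed.

Lemma polygon_le (F : realFieldType) (c : F) M L v (x : F) :
  `|polygon c M L v x| <= `|c| + \sum_(0 <= j < (2 * L).+1) `|v j|.
Proof.
apply: le_trans (ler_normD _ _) _; apply: lerD => //.
apply: le_trans (ler_norm_sum _ _ _) _; apply: ler_sum => j _.
rewrite normrM ler_piMr // ger0_norm ?tent_ge0 //.
by rewrite ge_max ler01 gerBl normr_ge0.
Qed.

Lemma polyR_continuous (R : realType) D : poly_valid D -> continuous (@polyR R D).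
Proof.
move=> Dv x; apply/cvgrPdist_lt => e e0.
have s0 : 0 < 2 ^+ datas D :> R by rewrite exprn_gt0.
near=> y; apply: le_lt_trans (polyR_lipschitz _ _ Dv) _.
rewrite mulrC -ltr_pdivlMr //.
near: y; apply/nbhs_ballP; exists (e / 2 ^+ datas D) => //=.
by rewrite divr_gt0.
Unshelve. all: by end_near. Qed.

Lemma polyR_Cb (R : realType) D : poly_valid D -> Cb (@polyR R D).
Proof.
move=> Dv; apply/CbP; split; first exact: polyR_continuous.
by eexists => x; exact: polygon_le.
Qed.

Definition const_list (c m : nat) : nat := iter m (fun r => <|c, r|>) 0%N.

Lemma nthc_const_list c m j : (j < m)%N -> nthc (const_list c m) j = c.
Proof.
rewrite /nthc /const_list; elim: m j => // m IH [|j] jm.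
  by rewrite /= unpair1K.
by rewrite iterSr /= unpair2K; exact: IH.
Qed.

(** Constant 1 minus the unit tents at the integers from -N to N. The node values have absolute sum
    2 * N + 1, which is below 2 to that power. *)
Definition tail_data (N : nat) : nat :=
  polydata <|<|1, 0|>, 0|> 0 N (const_list <|<|0, 1|>, 0|> (2 * N).+1)
    (2 * N).+1.

Lemma tail_data_valid N : poly_valid (tail_data N).
Proof.
rewrite /poly_valid; have [_ -> -> -> ->] := polydataE <|<|1, 0|>, 0|>%N 0 N
  (const_list <|<|0, 1|>, 0|>%N (2 * N).+1) (2 * N).+1.
rewrite (eq_big_nat _ _ (F2 := fun=> 1)) => [|j /andP[_ jN]].
  rewrite mulr1 big_const_nat subn0 iter_addr addr0.
  by rewrite ler_nat ltnW // ltn_expl.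
by rewrite nthc_const_list // ratn_pair sub0r divr1 normrN normr1.
Qed.

Lemma polyR_tail (R : realType) N : @polyR R (tail_data N) = tail N.
Proof.
apply/funext => x; rewrite /polyR /polygon.
have [-> -> -> -> _] := polydataE <|<|1, 0|>, 0|>%N 0 N
  (const_list <|<|0, 1|>, 0|>%N (2 * N).+1) (2 * N).+1.
rewrite ratn_pair subr0 divr1 rmorph1 /tail; congr (_ + _).
rewrite -sum_tent -sumrN; apply: eq_big_nat => j /andP[_ jN].
rewrite nthc_const_list // ratn_pair sub0r divr1 rmorphN rmorph1 mulN1r.
by rewrite mul1r.
Qed.

Lemma eff_tail_data N : eff N -> eff (fun p n => tail_data (N p n)).
Proof. by rewrite /tail_data /polydata /const_list => eN; effq. Qed.

Lemma Cb_tail (R : realType) N : Cb (@tail R N).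
Proof. by rewrite -polyR_tail; apply: polyR_Cb; exact: tail_data_valid. Qed.

Lemma tail_le (R : realType) (mu : finmeas R) N :
  integral_of mu (@tail R N) <= mass mu - fine (mu (@centered R N)).
Proof.
rewrite -mass_centered; apply: integral_of_le_indic.
- by apply: measurableC; exact: measurable_itv.
- exact: Cb_tail.
move=> x; rewrite indicE; case: (boolP (x \in _)) => [_|].
  exact: tail_le1.
rewrite notin_setE /= => /contrapT; rewrite /centered /= in_itv /=.
by move=> /andP[x1 x2]; rewrite tail_eq0 // !ltW.
Qed.

(** With [tail_le], this squeezes [tail N] between the indicators of the complements of ]-(N+1),
    N+1[ and ]-N, N[; passing between masses and integrals therefore costs one unit of [N]. *)
Lemma tail_ge (R : realType) (mu : finmeas R) N :
  mass mu - fine (mu (@centered R N.+1)) <= integral_of mu (@tail R N).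
Proof.
rewrite -mass_centered; apply: integral_of_ge_indic.
- by apply: measurableC; exact: measurable_itv.
- exact: Cb_tail.
move=> x; rewrite indicE; case: (boolP (x \in _)) => [|_]; last exact: tail_ge0.
rewrite inE /centered /= in_itv /= => /negP xN.
by rewrite tail_eq1 // leNgt ltr_norml.
Qed.

(** * From effective to uniformly effective weak convergence *)

Lemma itv_lo_lt_hi i : itv_lo i < itv_hi i.
Proof. by rewrite /itv_hi ltrDl posratn_gt0. Qed.

(** A compact-open name lists sets, not codes, so a set sought under the code [c] may appear under
    another code. These inequalities ensure that the other code passes every test that [c]
    passes. *)
Lemma conbhd_eq (R : realType) c c' : conbhd c = conbhd c' :> set (R -> R) ->
  [/\ itv_lo (unpair1 c') <= itv_lo (unpair1 c),
      itv_hi (unpair1 c) <= itv_hi (unpair1 c') &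
      posratn (unpair2 (unpair2 c')) <= posratn (unpair2 (unpair2 c))].
Proof.
move=> cc'.
pose I := unpair1 c; pose J := unpair2 c.
pose I' := unpair1 c'; pose J' := unpair2 c'.
have ltR i : ratr (itv_lo i) < ratr (itv_hi i) :> R.
  by rewrite ltr_rat itv_lo_lt_hi.
have sub g : continuous g -> (forall x, @compact_itv R I' x -> @open_itv R J' (g x)) ->
    forall x, @compact_itv R I x -> @open_itv R J (g x).
  move=> gc gI x Ix; have : conbhd c' g.
    by split=> // _ [z Iz <-]; exact: gI.
  by rewrite -cc' => -[_]; apply; exists x.
move=> {cc'}.
have subJ y : @open_itv R J' y -> @open_itv R J y.
  move=> J'y; apply: (sub (fun=> y) _ _ (ratr (itv_lo I))) => //.
    by move=> ?; exact: cvg_cst.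
  by rewrite /compact_itv /= in_itv /= lexx ltW.
pose y0 : R := (ratr (itv_lo J') + ratr (itv_hi J')) / 2.
have J'y0 : @open_itv R J' y0.
  by rewrite /open_itv /= in_itv /= /y0; have := ltR J' => ?; apply/andP; split; lra.
have Jy0 := subJ _ J'y0.
have y0h : y0 < ratr (itv_hi J).
  by move: Jy0; rewrite /open_itv /= in_itv /= => /andP[].
(* If I exceeds I' beyond the endpoint [e], such a ramp is constantly [y0] on I' but, for suitable
   [a], takes the excluded value sup J at a point of I. The sign [s] selects the side. *)
pose g (s e a z : R) := y0 + a * Num.max 0 (s * (z - e)).
have gc s e a : continuous (g s e a).
  move=> z; apply: cvgD; first exact: cvg_cst.
  apply: cvgMr; apply: (@continuous_max R R (fun=> 0) (fun z => s * (z - e))).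
    exact: cvg_cst.
  by apply: cvgMr; apply: cvgB; [exact: cvg_id|exact: cvg_cst].
have key s e z : @compact_itv R I z -> 0 < s * (z - e) ->
    (forall x, @compact_itv R I' x -> s * (x - e) <= 0) -> False.
  move=> Iz ze xe; pose a := (ratr (itv_hi J) - y0) / (s * (z - e)).
  have /(_ _ z Iz) := sub (g s e a) (gc s e a).
  rewrite /g max_r ?ltW // /a divfK ?gt_eqF // [y0 + (_ - _)]addrC subrK /open_itv /= in_itv /=.
  rewrite ltxx andbF => H; suff : false by []; apply: H => x I'x.
  by rewrite (max_l (xe x I'x)) mulr0 addr0.
split.
- rewrite leNgt; apply/negP; rewrite -(ltr_rat R) => lt.
  apply: (key (-1) (ratr (itv_lo I')) (ratr (itv_lo I))).
  + by rewrite /compact_itv /= in_itv /= lexx ltW.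
  + by rewrite /I /I'; lra.
  + by move=> x; rewrite /compact_itv /= in_itv /= => /andP[? _]; lra.
- rewrite leNgt; apply/negP; rewrite -(ltr_rat R) => lt.
  apply: (key 1 (ratr (itv_hi I')) (ratr (itv_hi I))).
  + by rewrite /compact_itv /= in_itv /= lexx ltW.
  + by rewrite /I /I'; lra.
  + by move=> x; rewrite /compact_itv /= in_itv /= => /andP[_ ?]; lra.
have loJ : itv_lo J <= itv_lo J'.
  rewrite leNgt; apply/negP; rewrite -(ltr_rat R) => lt.
  pose m : R := Num.min (ratr (itv_lo J)) (ratr (itv_hi J')).
  have lm : ratr (itv_lo J') < m by rewrite lt_min lt ltR.
  have m1 : m <= ratr (itv_lo J) by rewrite ge_min lexx.
  have m2 : m <= ratr (itv_hi J') by rewrite ge_min lexx orbT.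
  have /subJ : @open_itv R J' ((ratr (itv_lo J') + m) / 2).
    by rewrite /open_itv /= in_itv /=; apply/andP; split; lra.
  by rewrite /open_itv /= in_itv /= => /andP[? _]; lra.
have hiJ : itv_hi J' <= itv_hi J.
  rewrite leNgt; apply/negP; rewrite -(ltr_rat R) => lt.
  pose m : R := Num.max (ratr (itv_hi J)) (ratr (itv_lo J')).
  have lm : m < ratr (itv_hi J') by rewrite gt_max lt ltR.
  have m1 : ratr (itv_hi J) <= m by rewrite le_max lexx.
  have m2 : ratr (itv_lo J') <= m by rewrite le_max lexx orbT.
  have /subJ : @open_itv R J' ((ratr (itv_hi J') + m) / 2).
    by rewrite /open_itv /= in_itv /=; apply/andP; split; lra.
  by rewrite /open_itv /= in_itv /= => /andP[_ ?]; lra.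
by move: loJ hiJ; rewrite /itv_hi -/J -/J'; lra.
Qed.

(** * The test that bounds the tails *)

Definition halts (s i n : nat) : bool := (0 < run 0 s i n)%N.
Definition value (s i n : nat) : nat := (run 0 s i n).-1.

Lemma value_phi s i n : halts s i n -> phi i n (value s i n).
Proof. by move=> /prednK E; apply: (@run_sound s); rewrite E. Qed.

Lemma value_eq s i n v : halts s i n -> phi i n v -> value s i n = v.
Proof. by move=> /value_phi /phi_functional; apply. Qed.

Lemma run_near i n v : phi i n v -> \forall s \near \oo, run 0 s i n = v.+1.
Proof.
move=> /run_complete [s sv]; exists s => // s' ss'.
exact: run_monotone sv.
Qed.

Lemma eff_halts S I N : eff S -> eff I -> eff N ->
  eff (fun p n => halts (S p n) (I p n) (N p n)).
Proof. by rewrite /halts => eS eI eN; effq. Qed.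

Lemma eff_value S I N : eff S -> eff I -> eff N ->
  eff (fun p n => value (S p n) (I p n) (N p n)).
Proof. by rewrite /value => eS eI eN; effq. Qed.

(** [r] codes a rational below mu_n0(]-N, N[), and mu_n0(R) is known up to
    [2 ^- K.+2], so that the mass of mu_n0 outside of ]-N, N[ is less than
    [2 ^- K]; moreover [n0] is past a modulus, at precision [K], for the
    integrals of the tail function. *)
Definition tail_ok (eh ee : nat) (idx iU : nat -> nat) (K N n0 r s : nat) :
    bool :=
  let hn := value s eh n0 in
  let y := value s (unpair1 hn) (K + 3) in
  let j := value s (unpair2 hn) (iU N) in
  let m := value s ee <|idx (tail_data N), 1|> in
  [&& halts s eh n0, halts s (unpair1 hn) (K + 3),
      halts s (unpair2 hn) (iU N), halts s j r,
      ratn y + 2 * 2 ^- (K + 3) < ratn r + 2 ^- K,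
      halts s ee <|idx (tail_data N), 1|>, halts s m K &
      (value s m K <= n0)%N].

Lemma centered_subP (R : realType) N i :
  (@open_itv R i `<=` @centered R N) <->
  (- N%:R <= itv_lo i) && (itv_hi i <= N%:R).
Proof.
have ltR : ratr (itv_lo i) < ratr (itv_hi i) :> R.
  by rewrite ltr_rat itv_lo_lt_hi.
have NE : ratr (- N%:R) = - N%:R :> R by rewrite rmorphN /= ratr_nat.
rewrite -!(ler_rat R) NE ratr_nat; split=> [sub|/andP[Nl hN] x].
  apply/andP; split; rewrite leNgt; apply/negP => lt.
    pose m : R := Num.min (- N%:R) (ratr (itv_hi i)).
    have lm : ratr (itv_lo i) < m by rewrite lt_min lt ltR.
    have m1 : m <= - N%:R by rewrite ge_min lexx.
    have m2 : m <= ratr (itv_hi i) by rewrite ge_min lexx orbT.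
    have /sub : @open_itv R i ((ratr (itv_lo i) + m) / 2).
      by rewrite /open_itv /= in_itv /=; apply/andP; split; lra.
    by rewrite /centered /= in_itv /= => /andP[? _]; lra.
  pose m : R := Num.max N%:R (ratr (itv_lo i)).
  have lm : m < ratr (itv_hi i) by rewrite gt_max lt ltR.
  have m1 : N%:R <= m by rewrite le_max lexx.
  have m2 : ratr (itv_lo i) <= m by rewrite le_max lexx orbT.
  have /sub : @open_itv R i ((ratr (itv_hi i) + m) / 2).
    by rewrite /open_itv /= in_itv /=; apply/andP; split; lra.
  by rewrite /centered /= in_itv /= => /andP[_ ?]; lra.
rewrite /open_itv /centered /= !in_itv /= => /andP[x1 x2].
by apply/andP; split; lra.
Qed.

Lemma centered_index (R : realType) : exists2 iU : nat -> nat,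
  eff (fun _ N => iU N) & forall N, sigma1_index (@centered R N) (iU N).
Proof.
have [|iU eU UP] := @eff_ce (fun N i =>
    (- N%:R <= itv_lo i) && (itv_hi i <= N%:R)).
  have e1 : eff (fun _ n => unpair1 n) by eff.
  have e2 := effq_itv_lo (eff_unpair2 eff_id).
  have e3 := effq_itv_hi (eff_unpair2 eff_id).
  by effq.
exists iU => // N; split; first exact: interval_open.
rewrite /ce_index -[RHS]UP; apply/seteqP.
by split=> i /= /centered_subP.
Qed.

Section Tail.
Variables (R : realType) (mu_ : nat -> finmeas R) (mu : finmeas R).
Variables (h : nat -> nat) (eh ee : nat) (idx iU : nat -> nat).
Hypothesis heh : fun_index h eh.
Hypothesis hmu : forall n, measure_index (mu_ n) (h n).
Hypothesis mu_cvg : forall f, Cbc f ->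
  integral_of (mu_ n) f @[n --> \oo] --> integral_of mu f.
Hypothesis eeP : forall f i B,
    Cbc f -> realfun_index f i -> (forall x, `|f x| <= B%:R) ->
    exists2 m, phi ee <| i, B |> m &
    exists2 g, is_modulus (fun n => integral_of (mu_ n) f)
                          (integral_of mu f) g &
               fun_index g m.
Hypothesis idxP : forall D, poly_valid D -> realfun_index (@polyR R D) (idx D).
Hypothesis iUP : forall N, sigma1_index (@centered R N) (iU N).

Lemma Cbc_polyR D : poly_valid D -> Cbc (@polyR R D).
Proof.
move=> Dv; split; first by exists (idx D); exact: idxP.
by have [] := polyR_Cb R Dv.
Qed.

Lemma polyR_modulus D B : poly_valid D -> (forall x, `|@polyR R D x| <= B%:R) ->
  exists2 m, phi ee <| idx D, B |> m &
    exists2 g, is_modulus (fun n => integral_of (mu_ n) (@polyR R D))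
                          (integral_of mu (@polyR R D)) g & fun_index g m.
Proof. by move=> Dv DB; apply: eeP => //; [exact: Cbc_polyR|exact: idxP]. Qed.

Lemma tail_modulus N : exists2 m, phi ee <| idx (tail_data N), 1 |> m &
  exists2 g, is_modulus (fun n => integral_of (mu_ n) (@tail R N))
                        (integral_of mu (@tail R N)) g & fun_index g m.
Proof.
rewrite -!polyR_tail; apply: polyR_modulus; first exact: tail_data_valid.
by move=> x; rewrite polyR_tail ger0_norm ?tail_ge0 // tail_le1.
Qed.

Lemma tail_cvg N :
  integral_of (mu_ n) (@tail R N) @[n --> \oo] --> integral_of mu (@tail R N).
Proof.
by rewrite -polyR_tail; apply/mu_cvg/Cbc_polyR/tail_data_valid.
Qed.

Lemma fine_mu_centered (nu : finmeas R) N :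
  nu (@centered R N) = (fine (nu (@centered R N)))%:E.
Proof. by rewrite fineK // fin_num_measure //; exact: measurable_itv. Qed.

(** The test bounds the integral of the tail against mu_n0 by 2^-K. The modulus adds 2^-K on the way
    to the limit and another 2^-K on the way back to mu_n. *)
Lemma tail_sound K N n0 r s : tail_ok eh ee idx iU K N n0 r s ->
  integral_of mu (@tail R N) < 2 * 2 ^- K /\
  forall n, (n0 <= n)%N -> integral_of (mu_ n) (@tail R N) < 3 * 2 ^- K.
Proof.
rewrite /tail_ok /=; case/and4P=> h1; rewrite (value_eq h1 (heh n0)).
have [[p yp pP] cutP] := hmu n0.
move=> h2; rewrite (value_eq h2 (pP _)) => h3.
have [j /(value_eq h3) -> jP] := cutP _ _ (iUP N).
case/and4P=> h4; rewrite -(ltr_rat R) !(ratrD _ (ratn _)) (ratrM _ 2) !ratr_exp2V ratr_nat => hr.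
have [m /[swap] [[g gmod gm]] mP] := tail_modulus N.
move=> h5; rewrite (value_eq h5 mP) => /andP[h6].
rewrite (value_eq h6 (gm K)) => gn0.
have {jP} rN : ratr (ratn r) < fine (mu_ n0 (@centered R N)).
  suff : [set n | ((ratr (ratn n))%:E < mu_ n0 (@centered R N))%E] r.
    by rewrite /= fine_mu_centered lte_fin.
  by rewrite jP; exists (value s j r); exact: value_phi.
have := cauchy_name_dist (K + 3) yp; rewrite ler_norml => /andP[_ my].
have := tail_le (mu_ n0) N; have := gmod _ _ gn0; rewrite /mass ltr_norml.
move=> /andP[g1 g2] tl; split=> [|n nn0]; first lra.
have := gmod _ _ (leq_trans gn0 nn0); rewrite ltr_norml => /andP[g3 g4]; lra.
Qed.

(** If mu has mass less than d off ]-N, N[, then for large n the integral of [tail N] against mu_n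
    is less than 2 * d, which bounds the mass of mu_n off ]-(N+1), N+1[; the witness is thus [N.+1].
    The errors of [r] and of the name of the mass still fit into 2^-K = 8 * d. *)
Lemma tail_complete K : exists N n0 r,
  \forall s \near \oo, tail_ok eh ee idx iU K N n0 r s.
Proof.
pose d : R := 2 ^- (K + 3).
have d0 : 0 < d := exp2V_gt0 R _.
have dK : 2 ^- K = 8 * d :> R.
  rewrite /d exprD invfM mulrCA.
  by rewrite (_ : 8 = 2 ^+ 3) ?mulfV ?mulr1 // -natrX.
have [N NP] := centered_cvg mu d0.
have tN : integral_of mu (@tail R N) < d := le_lt_trans (tail_le mu N) NP.
have [m mP [g gmod gm]] := tail_modulus N.+1.
have /cvgrPdist_lt /(_ _ d0) [n1 _ n1P] := @tail_cvg N.
pose n0 := maxn n1 (g K).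
have tn0 : integral_of (mu_ n0) (@tail R N) < 2 * d.
  by have := n1P n0 (leq_maxl _ _); rewrite /= ltr_norml => /andP[? _]; lra.
have mn0 := le_lt_trans (tail_ge (mu_ n0) N) tn0.
have [[p yp pP] cutP] := hmu n0.
have [j jP jcut] := cutP _ _ (iUP N.+1).
have [|q] := @rat_in_itvoo R (fine (mu_ n0 (@centered R N.+1)) - d)
                (fine (mu_ n0 (@centered R N.+1))); first by lra.
rewrite in_itv /= => /andP[q1 q2]; have [r rq] := ratn_surj q.
have [v jr] : exists v, phi j r v.
  have : [set n | ((ratr (ratn n))%:E < mu_ n0 (@centered R N.+1))%E] r.
    by rewrite /= fine_mu_centered lte_fin rq.
  by rewrite jcut.
exists N.+1, n0, r; near=> s.
have E1 : run 0 s eh n0 = (h n0).+1 by near: s; exact: run_near.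
have E2 : run 0 s (unpair1 (h n0)) (K + 3) = (p (K + 3)%N).+1.
  by near: s; exact: run_near.
have E3 : run 0 s (unpair2 (h n0)) (iU N.+1) = j.+1 by near: s; exact: run_near.
have E4 : run 0 s j r = v.+1 by near: s; exact: run_near.
have E5 : run 0 s ee <|idx (tail_data N.+1), 1|> = m.+1.
  by near: s; exact: run_near.
have E6 : run 0 s m K = (g K).+1 by near: s; apply: run_near; exact: gm.
rewrite /tail_ok /halts /value E1 /= E2 E3 /= E4 E5 /= E6 /=.
rewrite leq_maxr andbT -(ltr_rat R) !(ratrD _ (ratn _)) (ratrM _ 2) !ratr_exp2V ratr_nat rq dK -/d.
have := cauchy_name_dist (K + 3) yp; rewrite -/(mass _) -/d ler_norml.
by move=> /andP[my _]; lra.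
Unshelve. all: by end_near. Qed.

End Tail.

(** * Polygons read off a compact-open name *)

Definition item_ok (K L M j c v : nat) : bool :=
  [&& itv_lo (unpair1 c) <= (j%:R - L%:R - 1) * M.+1%:R^-1,
      (j%:R - L%:R + 1) * M.+1%:R^-1 <= itv_hi (unpair1 c),
      posratn (unpair2 (unpair2 c)) < 2 ^- K &
      v == unpair1 (unpair2 c)].

Definition approx_data (N M vl s : nat) : nat :=
  polydata <|<|0, 0|>, 0|> M (N.+1 * M.+1) vl s.

Definition approx_ok (p : nat -> nat) (K N M al vl s : nat) : bool :=
  poly_valid (approx_data N M vl s) &&
  all (fun j => item_ok K (N.+1 * M.+1) M j (p (nthc al j)) (nthc vl j))
      (iota 0 (2 * (N.+1 * M.+1)).+1).

Lemma polyR_approx (R : realType) N M vl s (x : R) :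
  polyR (approx_data N M vl s) x =
  polygon 0 M (N.+1 * M.+1) (fun j => ratr (ratn (nthc vl j))) x.
Proof.
rewrite /polyR; have [-> -> -> -> _] := polydataE <|<|0, 0|>, 0|>%N M
  (N.+1 * M.+1) vl s.
by rewrite ratn_pair subrr mul0r rmorph0.
Qed.

Lemma co_name_conbhd (R : realType) (f : R -> R) p n :
  co_name f p -> conbhd (p n) f.
Proof.
move=> fp; have : range (fun n => conbhd (p n) : set (R -> R)) (conbhd (p n)).
  by exists n.
by rewrite fp => -[c cf <-].
Qed.

(** [item_ok] asks that the compact interval contain the support of the j-th tent and takes as node
    value the left end of an open interval shorter than 2^-K, in which [f] stays on that support. *)
Lemma item_sound (R : realType) (f : R -> R) p K L M j a v (x : R) :
    co_name f p -> item_ok K L M j (p a) v ->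
    `|M.+1%:R * x + L%:R - j%:R| <= 1 ->
  `|f x - ratr (ratn v)| <= 2 ^- K.
Proof.
move=> /(@co_name_conbhd _ _ _ a) [_ sub] /and4P[lo hi len /eqP ->].
rewrite ler_norml => /andP[x1 x2].
have M0 : 0 < M.+1%:R :> R by rewrite ltr0n.
have /sub : (f @` compact_itv (unpair1 (p a))) (f x).
  exists x => //; rewrite /compact_itv /= in_itv /=.
  move: lo hi; rewrite -!(ler_rat R) !ratrM !fmorphV /= ratrD !ratrB !ratr_nat.
  rewrite rmorph1 => lo hi; apply/andP; split.
    by apply: (le_trans lo); rewrite ler_pdivrMr //; lra.
  by apply: le_trans hi; rewrite ler_pdivlMr //; lra.
rewrite /open_itv /= in_itv /= /itv_hi /itv_lo ratrD.
move: len; rewrite -(ltr_rat R) ratr_exp2V => len /andP[f1 f2].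
by rewrite ler_norml; apply/andP; split; lra.
Qed.

Lemma approx_sound (R : realType) (f : R -> R) p B K N M al vl s
    (psi := @polyR R (approx_data N M vl s)) :
    co_name f p -> (forall x, `|f x| <= B%:R) ->
    approx_ok p K N M al vl s ->
  [/\ poly_valid (approx_data N M vl s),
      forall x, `|psi x| <= B.+1%:R &
      forall x, `|f x - psi x| <= 2 ^- K + B%:R * tail N x].
Proof.
move=> fp fB /andP[Dv /allP items].
pose L := (N.+1 * M.+1)%N.
have item j x : (j <= 2 * L)%N -> `|M.+1%:R * x + L%:R - j%:R| <= 1 ->
    `|f x - ratr (ratn (nthc vl j))| <= 2 ^- K.
  move=> jL; apply: item_sound fp _; apply: items.
  by rewrite mem_iota /= add0n ltnS.
split=> // x; rewrite /psi polyR_approx.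
  apply: polygon_bound => [j jL|]; last by rewrite ler0n.
  have M0 : M.+1%:R != 0 :> R by rewrite pnatr_eq0.
  (* At its own node the estimate compares [v j] with a value of [f]; as 2^-K <= 1, the node values
     are bounded by B + 1. *)
  have := item j ((j%:R - L%:R) / M.+1%:R) jL.
  rewrite mulrC divfK // subrK subrr normr0 ler01 => /(_ isT) fv.
  have := fB ((j%:R - L%:R) / M.+1%:R); rewrite -[B.+1%:R]natr1.
  have K1 : 2 ^- K <= 1 :> R by have := exp2V_le R (leq0n K); rewrite expr0 invr1.
  move: fv; set u := f _; set v := ratr _ => fv uB.
  have -> : v = u - (u - v) by rewrite opprB addrC subrK.
  by apply: le_trans (ler_normB _ _) _; lra.
by apply: polygon_approx => // j jL; exact: item.
Qed.

(** Uniform continuity on [-N, N], with the variation of [f] near [x] expressed by a rational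
    interval, as a compact-open name can certify it. *)
Lemma uniform_conbhd (R : realType) (f : R -> R) (K N : nat) : continuous f ->
  exists M, forall x : R, `|x| <= N%:R -> exists2 J,
    posratn (unpair2 J) < 2 ^- K &
    forall y, `|x - y| <= M.+1%:R^-1 -> @open_itv R J (f y).
Proof.
move=> fc; pose P (M : nat) (x : R) := exists2 J,
    posratn (unpair2 J) < 2 ^- K &
    forall y, `|x - y| <= M.+1%:R^-1 -> @open_itv R J (f y).
have : \forall M \near \oo, forall x, `[- N%:R, N%:R]%classic x -> P M x.
  have /compact_near_coveringP := @segment_compact R (- N%:R) N%:R.
  apply => x _; pose l : R := 2 ^- K.+1.
  have l0 : 0 < l := exp2V_gt0 R _.
  have [|q] := @rat_in_itvoo R (f x - l) (f x); first by lra.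
  rewrite in_itv /= => /andP[q1 q2]; have [a aq] := ratn_surj q.
  have [b bl] := posratn_surj (exp2V_gt0 rat K.+1).
  pose J := <|a, b|>%N.
  have JE y : @open_itv R J y = (ratr q < y < ratr q + l) :> Prop.
    rewrite /open_itv /= in_itv /= /itv_hi /itv_lo !unpairE aq bl ratrD.
    by rewrite ratr_exp2V.
  pose e := Num.min (f x - ratr q) (ratr q + l - f x).
  have e0 : 0 < e by rewrite lt_min !subr_gt0 q2; lra.
  have e1 : e <= f x - ratr q by rewrite ge_min lexx.
  have e2 : e <= ratr q + l - f x by rewrite ge_min lexx orbT.
  have /cvgrPdist_lt /(_ _ e0) /nbhs_ballP [d /= d0 dP] := fc x.
  have d2 : 0 < d / 2 by rewrite divr_gt0.
  have nearx : \forall x' \near x, `|x - x'| < d / 2.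
    by apply/nbhs_ballP; exists (d / 2); [exact: d2|].
  have nearM : \forall M \near \oo, `|M.+1%:R^-1| < d / 2.
    by move: (@cvg_harmonic R) => /cvgr0Pnorm_lt; apply.
  near=> x' M; exists J => [|y x'y].
    by rewrite unpair2K bl exp2V_S ltr_pdivrMr // ltr_pMr ?exp2V_gt0 // ltr1n.
  have x'd : `|x - x'| < d / 2 by near: x'.
  have Md : `|M.+1%:R^-1| < d / 2 by near: M.
  rewrite JE; have : `|f x - f y| < e.
    apply: dP; rewrite /ball /=; apply: le_lt_trans (ler_distD x' _ _) _.
    rewrite (splitr d); apply: ltrD => //; apply: le_lt_trans x'y _.
    exact: le_lt_trans (ler_norm _) Md.
  by rewrite ltr_norml => /andP[? ?]; apply/andP; split; lra.
move=> [M _ /(_ M (leqnn M)) MP]; exists M => x xN; apply: MP.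
by rewrite /= in_itv /= -ler_norml.
Unshelve. all: by end_near. Qed.

Lemma approx_complete (R : realType) (f : R -> R) p K N :
    continuous f -> co_name f p ->
  exists M al vl s, approx_ok p K N M al vl s.
Proof.
move=> fc fp; have [M MP] := uniform_conbhd K N.+1 fc.
pose L := (N.+1 * M.+1)%N.
have M0 : 0 < M.+1%:R :> rat by rewrite ltr0n.
have M0R : 0 < M.+1%:R :> R by rewrite ltr0n.
have /choice [a aP] : forall j, exists a, (j <= 2 * L)%N ->
    item_ok K L M j (p a) (unpair1 (unpair2 (p a))).
  move=> j; case: (leqP j (2 * L)) => [jL|_]; last by exists 0%N.
  have [|J Jlen JP] := MP ((j%:R - L%:R) / M.+1%:R).
    rewrite normrM [X in _ * X]gtr0_norm ?invr_gt0 // ler_pdivrMr //.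
    rewrite -natrM -/L ler_norml.
    have jL' : j%:R <= 2 * L%:R :> R by rewrite -natrM ler_nat.
    have j0 : 0 <= j%:R :> R by rewrite ler0n.
    by apply/andP; split; lra.
  have [lo loE] := ratn_surj ((j%:R - L%:R - 1) * M.+1%:R^-1).
  have [|len lenE] := @posratn_surj (2 * M.+1%:R^-1).
    by rewrite mulr_gt0 ?invr_gt0.
  pose c := <|<|lo, len|>, J|>%N.
  have loI : itv_lo (unpair1 c) = (j%:R - L%:R - 1) * M.+1%:R^-1.
    by rewrite /itv_lo !unpairE loE.
  have hiI : itv_hi (unpair1 c) = (j%:R - L%:R + 1) * M.+1%:R^-1.
    by rewrite /itv_hi loI !unpairE lenE; ring.
  have cf : conbhd c f.
    split=> // _ [y Iy <-]; rewrite unpair2K; apply: JP.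
    have loR : ratr (itv_lo (unpair1 c)) =
        (j%:R - L%:R) / M.+1%:R - M.+1%:R^-1 :> R.
      by rewrite loI ratrM fmorphV /= !ratrB !ratr_nat; ring.
    have hiR : ratr (itv_hi (unpair1 c)) =
        (j%:R - L%:R) / M.+1%:R + M.+1%:R^-1 :> R.
      by rewrite hiI ratrM fmorphV /= ratrD ratrB !ratr_nat; ring.
    move: Iy; rewrite /compact_itv /= in_itv /= loR hiR => Iy.
    by rewrite distrC ler_distl.
  (* The name contains the set coded by [c], perhaps under another code [p n], to which the bounds
     are transferred by [conbhd_eq]. *)
  have [n _ nE] : range (fun n => conbhd (p n) : set (R -> R)) (conbhd c).
    by rewrite fp; exists c.
  have [lo' hi' len'] := conbhd_eq (esym nE).
  exists n => _; rewrite /item_ok -loI -hiI lo' hi' eqxx andbT /=.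
  by apply: le_lt_trans len' _; rewrite unpair2K.
have [al alP] := nthc_surj a (2 * L).+1.
have [vl vlP] := nthc_surj (fun j => unpair1 (unpair2 (p (a j)))) (2 * L).+1.
pose X : rat := (\sum_(0 <= j < (2 * L).+1) `|ratn (nthc vl j)|) * M.+1%:R.
exists M, al, vl, (Num.truncn X).+1; apply/andP; split.
  rewrite /poly_valid; have [_ -> -> -> ->] := polydataE <|<|0, 0|>, 0|>%N M
    (N.+1 * M.+1) vl (Num.truncn X).+1.
  apply/ltW; apply: lt_trans (truncnS_gt X) _.
  by rewrite ltr_nat ltn_expl.
apply/allP => j; rewrite mem_iota /= add0n => jL.
by rewrite alP // vlP //; exact: aP.
Unshelve. all: by end_near. Qed.

(** * The search for a witness and its error bound *)

Ltac eff_fun_step :=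
  lazymatch goal with
  | H : eff (fun _ a => ?f a) |- eff (fun p n => ?f (@?X p n)) =>
      refine (@eff_comp (fun _ a => f a) X H _)
  | |- eff (fun p n => nat_of_bool (halts _ _ _)) => apply: eff_halts
  | |- eff (fun p n => value _ _ _) => apply: eff_value
  | |- eff (fun p n => tail_data _) => apply: eff_tail_data
  | _ => effq_step
  end.
Ltac eff_ext ::= eff_fun_step.

Lemma eff_tail_ok eh ee (idx iU : nat -> nat) K N T P S :
    eff (fun _ a => idx a) -> eff (fun _ a => iU a) ->
    eff K -> eff N -> eff T -> eff P -> eff S ->
  eff (fun p n =>
    tail_ok eh ee idx iU (K p n) (N p n) (T p n) (P p n) (S p n)).
Proof.
move=> eidx eiU eK eN eT eP eS; rewrite /tail_ok; cbv zeta.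
by effq.
Qed.

Lemma eff_approx_data N M V S : eff N -> eff M -> eff V -> eff S ->
  eff (fun p n => approx_data (N p n) (M p n) (V p n) (S p n)).
Proof. by rewrite /approx_data /polydata => eN eM eV eS; eff. Qed.

Lemma eff_item_ok K L M J C V :
    eff K -> eff L -> eff M -> eff J -> eff C -> eff V ->
  eff (fun p n =>
    item_ok (K p n) (L p n) (M p n) (J p n) (C p n) (V p n)).
Proof.
move=> eK eL eM eJ eC eV; rewrite /item_ok.
have eCl := effq_itv_lo (eff_unpair1 eC).
have eCh := effq_itv_hi (eff_unpair1 eC).
by effq.
Qed.

Lemma eff_approx_ok K N M A V S :
    eff K -> eff N -> eff M -> eff A -> eff V -> eff S ->
  eff (fun p n =>
    approx_ok p (K p n) (N p n) (M p n) (A p n) (V p n) (S p n)).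
Proof.
move=> eK eN eM eA eV eS; rewrite /approx_ok; apply: eff_andb.
  by apply: eff_poly_valid; exact: eff_approx_data.
apply: eff_all; first by eff.
by apply: eff_item_ok; eff.
Qed.

(** [q] packs [B] and the precision k. The entries of [w] are, in order: N, n0, r, the step bound s,
    M, the positions in the name, the node values, and the Lipschitz exponent. [B.+1] bounds the
    polygon, and [K] is chosen for [error_le]. *)
Definition witness_ok (eh ee : nat) (idx iU : nat -> nat) (C : nat)
    (p : nat -> nat) (q w : nat) : bool :=
  let B := unpair1 q in
  let K := (unpair2 q + B + C + 5)%N in
  let s := nthc w 3 in
  let D := approx_data (nthc w 0) (nthc w 4) (nthc w 6) (nthc w 7) in
  let m := value s ee <|idx D, B.+1|> in
  [&& tail_ok eh ee idx iU K (nthc w 0) (nthc w 1) (nthc w 2) s,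
      approx_ok p K (nthc w 0) (nthc w 4) (nthc w 5) (nthc w 6) (nthc w 7),
      halts s ee <|idx D, B.+1|> & halts s m K].

Definition witness_modulus (ee : nat) (idx : nat -> nat) (C q w : nat) : nat :=
  let B := unpair1 q in
  let K := (unpair2 q + B + C + 5)%N in
  let s := nthc w 3 in
  let D := approx_data (nthc w 0) (nthc w 4) (nthc w 6) (nthc w 7) in
  maxn (nthc w 1) (value s (value s ee <|idx D, B.+1|>) K).

Lemma eff_witness_ok eh ee idx iU C :
    eff (fun _ a => idx a) -> eff (fun _ a => iU a) ->
  eff (fun p n => witness_ok eh ee idx iU C p (unpair1 n) (unpair2 n)).
Proof.
move=> eidx eiU; rewrite /witness_ok; cbv zeta.
have eD : eff (fun p n => approx_data (nthc (unpair2 n) 0)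
  (nthc (unpair2 n) 4) (nthc (unpair2 n) 6) (nthc (unpair2 n) 7)).
  by apply: eff_approx_data; eff.
apply: eff_andb; first by apply: eff_tail_ok; eff.
apply: eff_andb; first by apply: eff_approx_ok; eff.
have eI := eff_comp eidx eD.
by eff.
Qed.

Lemma eff_witness_modulus ee idx C : eff (fun _ a => idx a) ->
  eff (fun _ n => witness_modulus ee idx C (unpair1 n) (unpair2 n)).
Proof.
move=> eidx; rewrite /witness_modulus /maxn; cbv zeta.
have eD : eff (fun p n => approx_data (nthc (unpair2 n) 0)
  (nthc (unpair2 n) 4) (nthc (unpair2 n) 6) (nthc (unpair2 n) 7)).
  by apply: eff_approx_data; eff.
have eI := eff_comp eidx eD.
by eff.
Qed.

(** In units of 2^-K the error is 1 from the modulus for the polygon, [C] for the mass of each of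
    mu_n and mu, and 3 * B and 2 * B from their tails. The exponent works because B < 2^B, C < 2^C
    and 2^5 = 32. *)
Lemma error_le (R : realFieldType) (B C k : nat) :
  (1 + 2 * C%:R + 5 * B%:R) * 2 ^- (k + B + C + 5)%N < 2 ^- k :> R.
Proof.
have -> : 2 ^- (k + B + C + 5)%N = 2 ^- k * 2 ^- (B + C + 5)%N :> R.
  by rewrite -invfM -exprD !addnA.
rewrite mulrCA -[ltRHS]mulr1 ltr_pM2l ?exp2V_gt0 //.
rewrite ltr_pdivrMr ?exprn_gt0 // mul1r -natrX.
have -> : 1 + 2 * C%:R + 5 * B%:R = (1 + 2 * C + 5 * B)%N%:R :> R.
  by rewrite natrD natrD !natrM.
rewrite ltr_nat !expnD.
have := ltn_expl B (isT : 1 < 2)%N; have := ltn_expl C (isT : 1 < 2)%N.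
by move: (2 ^ B)%N (2 ^ C)%N => x y; rewrite (_ : 2 ^ 5 = 32)%N //; nia.
Qed.

Section Main.
Variables (R : realType) (mu_ : nat -> finmeas R) (mu : finmeas R).
Variables (h : nat -> nat) (eh ee : nat) (idx iU : nat -> nat) (C : nat).
Hypothesis heh : fun_index h eh.
Hypothesis hmu : forall n, measure_index (mu_ n) (h n).
Hypothesis mu_cvg : forall f, Cbc f ->
  integral_of (mu_ n) f @[n --> \oo] --> integral_of mu f.
Hypothesis eeP : forall f i B,
    Cbc f -> realfun_index f i -> (forall x, `|f x| <= B%:R) ->
    exists2 m, phi ee <| i, B |> m &
    exists2 g, is_modulus (fun n => integral_of (mu_ n) f)
                          (integral_of mu f) g &
               fun_index g m.
Hypothesis idxP : forall D, poly_valid D -> realfun_index (@polyR R D) (idx D).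
Hypothesis iUP : forall N, sigma1_index (@centered R N) (iU N).
Hypothesis mass_le : forall n, mass (mu_ n) <= C%:R.
Hypothesis mass_lim_le : mass mu <= C%:R.

Lemma witness_sound (f : R -> R) p B k w : Cb f -> co_name f p -> (forall x, `|f x| <= B%:R) ->
    witness_ok eh ee idx iU C p <|B, k|> w ->
  forall n, (witness_modulus ee idx C <|B, k|> w <= n)%N ->
    `|integral_of (mu_ n) f - integral_of mu f| < 2 ^- k.
Proof.
move=> Cf fp fB; rewrite /witness_ok /witness_modulus !unpairE.
set K := (k + B + C + 5)%N; set N := nthc w 0; set n0 := nthc w 1.
set s := nthc w 3; set D := approx_data _ _ _ _.
case/and4P=> tok aok h1 h2 n; rewrite geq_max => /andP[n0n gn].
have [tl tn] := tail_sound heh hmu eeP idxP iUP tok.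
have [Dv DB fD] := approx_sound fp fB aok.
have [m mP [g gmod gm]] := polyR_modulus eeP idxP Dv DB.
rewrite (value_eq h1 mP) in h2 gn; rewrite (value_eq h2 (gm K)) in gn.
have psi := gmod _ _ gn.
have CD := polyR_Cb R Dv; have Ct := Cb_tail R N.
have dn := integral_of_dist (mu_ n) Cf CD Ct fD.
have dm := integral_of_dist mu Cf CD Ct fD.
apply: le_lt_trans (error_le R B C k).
have K0 : 0 < 2 ^- K :> R := exp2V_gt0 R K.
have Bn : B%:R * integral_of (mu_ n) (@tail R N) <= B%:R * (3 * 2 ^- K).
  by rewrite ler_wpM2l // ltW // tn.
have Bm : B%:R * integral_of mu (@tail R N) <= B%:R * (2 * 2 ^- K).
  by rewrite ler_wpM2l // ltW.
have Cn : 2 ^- K * mass (mu_ n) <= 2 ^- K * C%:R by rewrite ler_pM2l.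
have Cm : 2 ^- K * mass mu <= 2 ^- K * C%:R by rewrite ler_pM2l.
rewrite -/K; move: dn dm psi.
rewrite -/D; set u := integral_of _ f; set v := integral_of mu f.
set u' := integral_of _ (polyR D); set v' := integral_of mu (polyR D) => dn dm psi.
have -> : u - v = (u - u') + (u' - v') - (v - v') by ring.
apply: le_trans (ler_normB _ _) _; apply: le_trans (lerD (ler_normD _ _) (lexx _)) _.
move: Bn Bm Cn Cm dn dm psi; move: (2 ^- K) K0 (B%:R : R) (C%:R : R) => e e0 b c.
lra.
Qed.

Lemma witness_exists (f : R -> R) p B k : Cb f -> co_name f p -> (forall x, `|f x| <= B%:R) ->
  exists w, witness_ok eh ee idx iU C p <|B, k|> w.
Proof.
move=> Cf fp fB; pose K := (k + B + C + 5)%N.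
have [N [n0 [r near_tail]]] := tail_complete heh hmu mu_cvg eeP idxP iUP K.
have [M [al [vl [s' aok]]]] := approx_complete K N Cf.1 fp.
have [Dv DB _] := approx_sound fp fB aok.
have [m mP [g gmod gm]] := polyR_modulus eeP idxP Dv DB.
have [s [tok E1 E2]] : exists s, [/\ tail_ok eh ee idx iU K N n0 r s,
    run 0 s ee <|idx (approx_data N M vl s'), B.+1|> = m.+1 &
    run 0 s m K = (g K).+1].
  near \oo => s; exists s; split.
  - by near: s.
  - by near: s; exact: run_near.
  - by near: s; apply: run_near; exact: gm.
have [w wP] := nthc_surj (nth 0%N [:: N; n0; r; s; M; al; vl; s']) 8.
exists w; rewrite /witness_ok !unpairE !wP //= -/K tok aok.
by rewrite /halts /value E1 /= E2.
Unshelve. all: by end_near. Qed.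

End Main.

(** The name is chosen classically: each code is kept or replaced by the filler according to the
    truth of membership. *)
Lemma co_name_exists (R : realType) (f : R -> R) B :
  continuous f -> (forall x, `|f x| <= B%:R) -> exists p, co_name f p.
Proof.
move=> fc fB; exists (fun n => if `[< conbhd n f >] then n else bound_conbhd B).
apply/seteqP; split=> [_ [n _ <-]|_ [c cf <-]].
  eexists; last reflexivity.
  by case: asboolP => //= _; exact: bound_conbhdP.
by exists c => //; rewrite asboolT.
Qed.

(** The constant 1 as a polygon with a single zero node; its integrals are the total masses. *)
Definition one_data : nat :=
  polydata <|<|1, 0|>, 0|> 0 0 (const_list <|<|0, 0|>, 0|> 1) 0.

Lemma one_data_valid (R : realType) :
  poly_valid one_data /\ @polyR R one_data = fun=> 1.
Proof.
have [E1 E2 E3 E4 E5] := polydataE <|<|1, 0|>, 0|>%N 0 0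
  (const_list <|<|0, 0|>, 0|>%N 1) 0.
have E0 : ratn (nthc (const_list <|<|0, 0|>, 0|>%N 1) 0) = 0.
  by rewrite nthc_const_list // ratn_pair subrr mul0r.
split; first by rewrite /poly_valid E2 E3 E4 E5 big_nat1 E0 normr0 mul0r.
apply/funext => x; rewrite /polyR /polygon E1 E2 E3 E4 big_nat1 E0.
by rewrite rmorph0 mul0r addr0 ratn_pair subr0 divr1 rmorph1.
Qed.

Lemma uniformly_of_effectively (R : realType) (mu_ : nat -> finmeas R) mu :
  uniformly_computable mu_ -> effectively_weakly_converges mu_ mu ->
  uniformly_effectively_weakly_converges mu_ mu.
Proof.
move=> [h [eh heh] hmu] [mu_cvg [ee eeP]].
have [idx eidx idxP] := poly_index R.
have [iU eiU iUP] := centered_index R.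
have Cbc1 : Cbc (fun=> 1 : R).
  split; last by have [] := Cb_cst (1 : R).
  have [Dv D1] := one_data_valid R.
  by exists (idx one_data); rewrite -D1; exact: idxP.
(* The masses are the integrals of 1, hence converge and are bounded. [C] depends only on the
   sequence and its limit, so it may be built into the index [e]. *)
have [C mass_le mass_lim_le] : exists2 C : nat,
    (forall n, mass (mu_ n) <= C%:R) & mass mu <= C%:R.
  have := mu_cvg _ Cbc1.
  have -> : integral_of mu (fun=> 1) = mass mu by rewrite integral_of_cst mul1r.
  rewrite (_ : (fun n => integral_of (mu_ n) (fun=> 1)) = (fun n => mass (mu_ n))).
    2: by apply/funext => n; rewrite integral_of_cst mul1r.
  move=> cv; have /cvg_seq_bounded [b [_ bP]] := cvgP _ cv.
  pose c := Num.max (b + 1) (mass mu).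
  have cC : c <= (Num.truncn c).+1%:R by rewrite ltW // truncnS_gt.
  exists (Num.truncn c).+1 => [n|]; apply: le_trans cC; rewrite le_max.
    by rewrite (le_trans (ler_norm _)) // bP // ltrDl.
  by rewrite lexx orbT.
have [e eP] := eff_search (@eff_witness_ok eh ee idx iU C eidx eiU) (@eff_witness_modulus ee idx C eidx).
have main f p B : Cb f -> co_name f p -> (forall x, `|f x| <= B%:R) ->
    exists2 g, is_modulus (fun n => integral_of (mu_ n) f)
                          (integral_of mu f) g &
               forall k, Phi e p <| B, k |> (g k).
  move=> Cf fp fB.
  have /choice [g gP] : forall k, exists v, Phi e p <|B, k|> v /\
      forall n, (v <= n)%N ->
        `|integral_of (mu_ n) f - integral_of mu f| < 2 ^- k.
    move=> k; have [w wP ew] := eP p <|B, k|>%N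
      (witness_exists C heh hmu mu_cvg eeP idxP iUP k Cf fp fB).
    exists (witness_modulus ee idx C <|B, k|> w); split; first by rewrite !unpairE in ew.
    exact: (witness_sound heh hmu eeP idxP iUP mass_le mass_lim_le Cf fp fB wP).
  by exists g => [k n|k]; [exact: (gP k).2|exact: (gP k).1].
split; last by exists e.
(* Convergence for an arbitrary [f] is read off the modulus that the procedure returns on some name
   of [f]. *)
move=> f Cf; have /CbP[fc [b fb]] := Cf.
have fB x : `|f x| <= (Num.truncn b).+1%:R.
  by rewrite (le_trans (fb x)) // ltW // truncnS_gt.
have [p fp] := co_name_exists fc fB.
have [g gmod _] := main f p _ Cf fp fB.
apply/cvgrPdist_lt => d d0; have [k kd] := exp2V_lt d0.
exists (g k) => // n gn; rewrite distrC; apply: lt_trans kd.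
exact: gmod.
Qed.

Theorem theorem4p3 (R : realType) (mu_ : nat -> finmeas R)
    (hmu : uniformly_computable mu_) :
  (exists mu : finmeas R, effectively_weakly_converges mu_ mu) <->
  (exists mu : finmeas R, uniformly_effectively_weakly_converges mu_ mu).
Proof.
split=> -[mu conv]; exists mu; first exact: uniformly_of_effectively.
exact: effectively_of_uniformly.
Qed.
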